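(* Let $\Gamma=(X,R)$ be a bipartite distance-regular graph with diameter $D\ge 4$, valency $k\ge 3$ and eigenvalues $\theta_0>\theta_1>\cdots>\theta_D$. Put $d=\lfloor D/2\rfloor$, fix $x\in X$ and let $T=T(x)$. Choose $n\in\{1,d\}$ if $D$ is odd, and let $n=1$ if $D$ is even. Let $W$ be a thin irreducible $T$-module with endpoint $2$ and local eigenvalue $\tilde\theta_n=-1-\dfrac{b_2b_3}{\theta_n^2-b_2}$. Let $g_0,g_1,\ldots,g_{D-2}\in\mathbb R[\lambda]$ be the polynomials defined in the context with $\theta=\theta_n$. Let $v$ be a nonzero vector in $E_2^*W$. Then for $0\le i\le D-4$, $$E_{i+2}^*A_iv=\sum_{\substack{1\le j\le D-1\\ j\ne n,\ j\ne D-n}}g_i(\theta_j)\,E_jv.$$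
   Context: Graphs are finite, undirected, connected, without loops or multiple edges; $\partial$ denotes path-length distance. A graph $\Gamma=(X,R)$ of diameter $D$ is distance-regular if for all $0\le h,i,j\le D$ and all $x,y\in X$ with $\partial(x,y)=h$ the number $p^h_{ij}=|\{z\in X:\partial(x,z)=i,\ \partial(z,y)=j\}|$ depends only on $h,i,j$. Write $c_i=p^i_{1,i-1}$ $(1\le i\le D)$, $b_i=p^i_{1,i+1}$ $(0\le i\le D-1)$, $k=b_0$ (the valency), $k_i=p^0_{ii}$. $\Gamma$ is bipartite if $X$ can be partitioned into two subsets neither of which contains an edge. For $0\le i\le D$, $A_i\in\mathrm{Mat}_X(\mathbb C)$ is the $i$th distance matrix: its $(y,z)$ entry is $1$ if $\partial(y,z)=i$ and $0$ otherwise; $A=A_1$ is the adjacency matrix. The distinct eigenvalues of $A$ are $\theta_0>\cdots>\theta_D$ (real); $E_i$ is the primitive idempotent of $\theta_i$, i.e. the orthogonal projection of $V=\mathbb C^X$ onto the $\theta_i$-eigenspace of $A$. For bipartite $\Gamma$ with $D\ge4$, $\theta_1^2>b_2>\theta_d^2$. Polynomials: $f_0,\ldots,f_D\in\mathbb R[\lambda]$ are defined by $f_{-1}=0$, $f_0=1$ and $\lambda f_i=b_{i-1}f_{i-1}+c_{i+1}f_{i+1}$ for $0\le i\le D-1$. For $0\le i\le D$, $p_i=f_0+f_2+\cdots+f_i$ if $i$ is even and $p_i=f_1+f_3+\cdots+f_i$ if $i$ is odd. With $\theta=\theta_n$ one has $p_i(\theta)\ne0$ for $0\le i\le D-2$,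 and for $0\le i\le D-2$ $$g_i=\sum_{\substack{0\le h\le i\\ i-h\text{ even}}}\frac{p_h(\theta)\,k_ib_ib_{i+1}}{p_i(\theta)\,k_hb_hb_{h+1}}\,p_h.$$ For fixed $x\in X$, $E_i^*=E_i^*(x)$ is the diagonal matrix in $\mathrm{Mat}_X(\mathbb C)$ with $(y,y)$ entry $1$ if $\partial(x,y)=i$ and $0$ otherwise. $T=T(x)$ is the subalgebra of $\mathrm{Mat}_X(\mathbb C)$ generated by $A,E_0^*,\ldots,E_D^*$. A $T$-module is a subspace $W\subseteq V$ with $BW\subseteq W$ for all $B\in T$; it is irreducible if it is nonzero and contains no $T$-modules other than $0$ and $W$. The endpoint of an irreducible $W$ is $\min\{i:E_i^*W\ne0\}$; $W$ is thin if $\dim E_i^*W\le1$ for $0\le i\le D$. If $W$ is thin irreducible with endpoint $2$, then $E_2^*W$ is a one-dimensional eigenspace for $E_2^*A_2E_2^*$; the corresponding eigenvalue is called the local eigenvalue of $W$. *)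

(* Defs.v *)
From mathcomp Require Import all_boot all_order all_algebra.
From mathcomp Require Import spectral.
From mathcomp Require Import reals.
From mathcomp Require Import complex.

Set Implicit Arguments.
Unset Strict Implicit.
Unset Printing Implicit Defensive.

Import Order.TTheory GRing.Theory Num.Theory.
Local Open Scope ring_scope.
Local Open Scope complex_scope.

Section Graphs.
Variables (X : finType) (e : rel X).

Definition connected_simple_graph : Prop :=
  [/\ symmetric e, irreflexive e & forall y z, connect e y z].

(* Least length of a walk from y to z; when z is reachable from y this is less
   than #|X|, so it is always found in a connected graph. *)
Definition gdist (y z : X) : nat :=
  find (fun l => [exists p : l.-tuple X, path e y p && (last y p == z)])
       (iota 0 #|X|).

Definition diameter : nat := (\max_(y : X) \max_(z : X) gdist y z)%N.

Definition bipartite : Prop :=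
  exists P : {set X},
    (forall y z, y \in P -> z \in P -> ~~ e y z) /\
    (forall y z, y \in ~: P -> z \in ~: P -> ~~ e y z).

Definition sphere_meet (i j : nat) (y z : X) : nat :=
  #|[set w | (gdist y w == i) && (gdist w z == j)]|.

Definition distance_regular : Prop :=
  forall h i j, (h <= diameter)%N -> (i <= diameter)%N -> (j <= diameter)%N ->
  forall y z y' z', gdist y z = h -> gdist y' z' = h ->
    sphere_meet i j y z = sphere_meet i j y' z'.

(* p^h_ij, read off an arbitrary pair of vertices at distance h (0 if there is
   none); independent of the pair when e is distance-regular. *)
Definition intersection_number (h i j : nat) : nat :=
  if [pick u : X * X | gdist u.1 u.2 == h] is Some u
  then sphere_meet i j u.1 u.2 else 0%N.

Definition cnum (i : nat) : nat := intersection_number i 1 i.-1.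
Definition bnum (i : nat) : nat := intersection_number i 1 i.+1.
Definition knum (i : nat) : nat := intersection_number 0 i i.
Definition valency : nat := bnum 0.

End Graphs.

Section Polynomials.
Variables (R : realType) (X : finType) (e : rel X).

Local Notation b i := ((bnum e i)%:R : R).
Local Notation c i := ((cnum e i)%:R : R).
Local Notation k i := ((knum e i)%:R : R).

(* 'X * f_i = b_(i-1) f_(i-1) + c_(i+1) f_(i+1), with f_(-1) = 0 and f_0 = 1,
   solved for f_(i+1). *)
Fixpoint fpoly (m : nat) : {poly R} :=
  match m with
  | 0 => 1
  | m'.+1 => match m' with
             | 0 => (c 1)^-1 *: 'X
             | j.+1 => (c j.+2)^-1 *: ('X * fpoly m' - b j *: fpoly j)
             end
  end.

Definition ppoly (i : nat) : {poly R} :=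
  \sum_(h < i.+1 | ~~ odd (i - h)) fpoly h.

Definition gpoly (theta : R) (i : nat) : {poly R} :=
  \sum_(h < i.+1 | ~~ odd (i - h))
    (((ppoly h).[theta] * k i * b i * b i.+1) /
     ((ppoly i).[theta] * k h * b h * b h.+1)) *: ppoly h.

End Polynomials.

(* Matrices with rows and columns indexed by the vertex set X are represented
   in 'M_#|X|, with index i standing for the vertex enum_val i.  They act on
   column vectors. *)
Section Matrices.
Variables (R : realType) (X : finType) (e : rel X).

Local Notation mat := 'M[R[i]]_#|X|.
Local Notation vec := 'cV[R[i]]_#|X|.

Definition dist_mx (i : nat) : mat :=
  \matrix_(y, z) (gdist e (enum_val y) (enum_val z) == i)%:R.

Definition adj_mx : mat := dist_mx 1.

Definition dual_idem (x : X) (i : nat) : mat :=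
  diag_mx (\row_y (gdist e x (enum_val y) == i)%:R).

Definition ordered_eigenvalues (D : nat) (theta : nat -> R) : Prop :=
  (forall i j, (i < j <= D)%N -> theta j < theta i) /\
  (forall a : R[i],
     eigenvalue adj_mx a <-> exists2 i, (i <= D)%N & a = (theta i)%:C).

(* eigenspace and proj_ortho follow the row-vector convention; the transposes
   turn them into the orthogonal projection, acting on columns, onto
   {v | A v = a v}. *)
Definition prim_idem (a : R[i]) : mat :=
  (proj_ortho (eigenspace adj_mx^T a))^T.

Inductive generated_algebra (S : mat -> Prop) : mat -> Prop :=
| gen_base B : S B -> generated_algebra S B
| gen_one : generated_algebra S 1%:M
| gen_add B C : generated_algebra S B -> generated_algebra S C ->
    generated_algebra S (B + C)
| gen_scale (a : R[i]) B : generated_algebra S B -> generated_algebra S (a *: B)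
| gen_mul B C : generated_algebra S B -> generated_algebra S C ->
    generated_algebra S (B *m C).

Definition terwilliger_algebra (x : X) : mat -> Prop :=
  generated_algebra (fun B =>
    B = adj_mx \/ exists2 i, (i <= diameter e)%N & B = dual_idem x i).

Definition Tmodule (x : X) (W : {vspace vec}) : Prop :=
  forall B w, terwilliger_algebra x B -> w \in W -> B *m w \in W.

Definition irreducible_Tmodule (x : X) (W : {vspace vec}) : Prop :=
  [/\ Tmodule x W, W != 0%VS &
      forall U : {vspace vec}, Tmodule x U -> (U <= W)%VS ->
        U = 0%VS \/ U = W].

Definition mx_img (B : mat) (W : {vspace vec}) : {vspace vec} :=
  (linfun (mulmx B : vec -> vec) @: W)%VS.

Definition endpoint (x : X) (W : {vspace vec}) : nat :=
  find (fun i => mx_img (dual_idem x i) W != 0%VS) (iota 0 (diameter e).+1).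

Definition thin (x : X) (W : {vspace vec}) : Prop :=
  forall i, (i <= diameter e)%N -> (\dim (mx_img (dual_idem x i) W) <= 1)%N.

(* Meant for W thin irreducible with endpoint 2, when E_2^* W is a line. *)
Definition local_eigenvalue (x : X) (W : {vspace vec}) (a : R[i]) : Prop :=
  forall w, w \in mx_img (dual_idem x 2) W ->
    dual_idem x 2 *m dist_mx 2 *m dual_idem x 2 *m w = a *: w.

End Matrices.

Arguments dist_mx R {X} e i.
Arguments adj_mx R {X} e.
Arguments dual_idem R {X} e x i.

(* Main.v *)
Require Import Defs.
From mathcomp Require Import all_boot all_order all_algebra.
From mathcomp Require Import reals complex.
From mathcomp Require Import spectral sesquilinear zify ring lra.

Set Implicit Arguments.
Unset Strict Implicit.
Unset Printing Implicit Defensive.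

Import Order.TTheory GRing.Theory Num.Theory.
Local Open Scope ring_scope.
Local Open Scope complex_scope.

(** Write [t] for [theta n], [p_i], [g_i] for the polynomials [ppoly e i] and
    [gpoly e t i], and put [v_i = E*_{i+2} A_i v], so that [v_0 = v].  The
    theorem says two things: [v_i = g_i(A) v] for [i <= D - 4], and [v] has no
    component in the eigenspaces of index [0], [D], [n] and [D - n].

    For the first, [A] is shown to act on the [v_i] by a three-term recurrence
    which is that of the [g_i].  As the graph is bipartite, [A] splits into a
    raising part, for which [v_i] goes to [c_{i+1} v_{i+1}], and a lowering
    part, for which [v_{i+1}] goes to a multiple of [v_i] because the module is
    thin.  The scalar is found together with the multiple of [v_i] that
    [E*_{i+2} A_{i+2} v] is: comparing components in
    [A A_{i+1} = b_i A_i + c_{i+2} A_{i+2}], applied to [v] at two different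
    distances, gives two relations between these unknowns at [i] and [i + 1]
    ([adj_dist_split1], [adj_dist_split3]).  They leave one free parameter, the
    local eigenvalue, and for the value in the theorem the solution is an
    explicit ratio of values [p_h(t)] ([thin_coefs]).  The same ratio governs
    the [g_i], which are, up to scalars, the kernel polynomials at [t] of the
    sequence [p_h], split by parity ([gpoly_rec]); this is a
    Christoffel-Darboux identity ([kernel_sum_rec]).

    The scalars involve division by [p_i(t)], which has to be nonzero for
    [i <= D - 2] ([ppoly_theta_neq0]).  The [p_i] are orthogonal for the weights
    [(k^2 - theta_j^2) tr E_j], and [t^2] is extremal among the [theta_j^2] with
    [0 < j < D]; if [p_i] were divisible by [X^2 - t^2], pairing it with the
    quotient would give a vanishing sum of terms of one sign.

    For the second, [v] is orthogonal to the all-ones vector since [W] has no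
    component at distance [0], and then also to the alternating one, which
    disposes of [theta_0 = k] and [theta_D = - k] ([prim_idem_ends_eq0]).
    Finally [p_{D-1}(t) = 0] makes the lowering scalar at the end of the chain
    vanish; raising and lowering being adjoint, [v_{D-3} = 0]
    ([top_vec_last]).  Hence [g_{D-3}(A) v = 0], whereas [g_{D-3}(t)] and
    [g_{D-3}(-t)] are nonzero as sums of squares up to a factor, so the
    components of [v] for [t] and [- t] vanish ([prim_idem_extremal_eq0]). *)

(** * Orthogonal projections onto the eigenspaces of a real symmetric matrix *)

Section Spectral.
Variables (C : numClosedFieldType) (n : nat) (A : 'M[C]_n).
Hypothesis (Asym : A^T = A) (Areal : A \is a mxOver Num.real).

Local Notation Q a := (proj_ortho (eigenspace A a)).

Lemma real_sym_adjoint : map_mx Num.conj A^T = A.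
Proof.
rewrite Asym; apply/matrixP => i j; rewrite mxE.
by apply/CrealP; exact: (mxOverP Areal).
Qed.

Lemma eigenspace_ortho a b : a \is Num.real -> a != b ->
  (eigenspace A b <= orthomx Num.conj
     (mx_of_hermitian (hermitian1mx n)) (eigenspace A a))%MS.
Proof.
move=> ra neq_ab; rewrite orthomx1E; set U := eigenspace A a.
set V := eigenspace A b.
have UA : U *m A = a *: U by exact/eigenspaceP.
have VA : V *m A = b *: V by exact/eigenspaceP.
have AU : A *m map_mx Num.conj U^T = a *: map_mx Num.conj U^T.
  rewrite -{1}real_sym_adjoint -map_mxM -trmx_mul UA.
  by apply/matrixP => i j; rewrite !mxE rmorphM /= (CrealP ra).
have: (b - a) *: (V *m map_mx Num.conj U^T) = 0.
  by rewrite scalerBl scalemxAl -VA -mulmxA AU -scalemxAr subrr.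
by move/eqP; rewrite scaler_eq0 subr_eq0 eq_sym (negPf neq_ab).
Qed.

Lemma mul_eigenproj a : Q a *m A = a *: Q a.
Proof. by apply/eigenspaceP; rewrite -{1}[Q a]mul1mx proj_ortho_sub. Qed.

Lemma eigenproj_mul a b : a \is Num.real ->
  Q b *m Q a = if b == a then Q a else 0.
Proof.
move=> ra; case: eqVneq => [->|neq_ba]; first exact: proj_ortho_proj.
apply: proj_ortho_0; apply: submx_trans (eigenspace_ortho ra _).
  by rewrite -{1}[Q b]mul1mx; exact: proj_ortho_sub.
by rewrite eq_sym.
Qed.

(** The rows of a unitary diagonalizing matrix are eigenvectors, and they form a
    basis on which the sum of the projections is the identity. *)
Lemma sum_eigenproj (s : seq C) : uniq s -> all [in Num.real] s ->
  (forall a, eigenvalue A a -> a \in s) -> \sum_(a <- s) Q a = 1%:M.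
Proof.
move=> us rs sP.
have An : A \is normalmx.
  apply/hermitian_normalmx/realsym_hermsym => //.
  by apply/is_hermitianmxP; rewrite expr0 scale1r Asym; apply/matrixP => i j;
     rewrite mxE.
have /orthomx_spectralP := An; set P := spectralmx A; set d := spectral_diag A.
move=> AE; have Pu : P \in unitmx by exact: spectral_unit.
have PA : P *m A = diag_mx d *m P by rewrite AE !mulmxA mulmxV // mul1mx.
apply: (can_inj (mulKmx Pu)); rewrite mulmx1; apply/row_matrixP => i.
have rowA : row i P *m A = d 0 i *: row i P.
  by rewrite -row_mul PA row_mul row_diag_mx -scalemxAl -rowE.
have rowin : (row i P <= eigenspace A (d 0 i))%MS by apply/eigenspaceP.
have din : d 0 i \in s.
  apply: sP; apply/eigenvalueP; exists (row i P) => //.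
  apply: contraTneq Pu => r0; rewrite -row_free_unit; apply/row_freePn.
  by exists i; rewrite r0 sub0mx.
rewrite row_mul mulmx_sumr (bigD1_seq (d 0 i)) //= proj_ortho_id // big1_seq ?addr0//.
move=> a /andP[neq_a ain]; apply: proj_ortho_0; apply: (submx_trans rowin).
by apply: eigenspace_ortho; rewrite ?(allP rs).
Qed.

(** This identity says that the projection is Hermitian; in this form it makes
    the trace a sum of squared moduli. *)
Lemma eigenproj_adjoint a : Q a *m map_mx Num.conj (Q a)^T = Q a.
Proof.
set U := eigenspace A a.
have QU : (Q a :=: U)%MS by exact: proj_orthoE.
have := proj_ortho_compl_sub U (1%:M : 'M_n); rewrite mul1mx.
rewrite -(eqmx_ortho _ QU) orthomx1E mulmxBl mul1mx subr_eq0 => /eqP h.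
move: (proj_ortho U) h => q h; rewrite -[RHS]trmxCK [in RHS]h trmx_mul map_mxM.
by rewrite trmxCK.
Qed.

Lemma eigenproj_trace_gt0 a : eigenvalue A a -> 0 < \tr (Q a).
Proof.
move=> ea.
have trE : \tr (Q a) = \sum_i \sum_j `|Q a i j| ^+ 2.
  move: (Q a) (eigenproj_adjoint a) => q {1}<-; apply: eq_bigr => i _.
  by rewrite mxE; apply: eq_bigr => j _; rewrite !mxE normCK.
have term_ge0 i j : 0 <= `|Q a i j| ^+ 2 by rewrite exprn_ge0.
have tr_ge0 : 0 <= \tr (Q a) by rewrite trE; do 2!apply: sumr_ge0 => ? _.
rewrite lt0r tr_ge0 andbT; apply: contraTneq ea; rewrite trE => /eqP tr0.
have Q0 : Q a = 0.
  apply/matrixP => i j; rewrite [RHS]mxE; apply/eqP; rewrite -normr_eq0.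
  rewrite -sqrf_eq0; move: tr0; rewrite psumr_eq0; last first.
    by move=> ? _; apply: sumr_ge0 => ? _.
  move/allP/(_ i (mem_index_enum _)) => /=; rewrite psumr_eq0 //.
  by move/allP/(_ j (mem_index_enum _)).
by rewrite /eigenvalue negbK -mxrank_eq0 -(proj_orthoE (eigenspace A a)) Q0 mxrank0.
Qed.

End Spectral.

(** * Sums over a range of indices *)

Lemma same_parity_sumSS (V : nmodType) (F : nat -> V) i :
  \sum_(h < i.+3 | ~~ odd (i.+2 - h)) F h =
  \sum_(h < i.+1 | ~~ odd (i - h)) F h + F i.+2.
Proof.
rewrite big_mkcond big_ord_recr big_ord_recr /= subnn /=.
have -> : (i.+2 - i.+1 = 1)%N by lia.
rewrite addr0 -big_mkcond; congr (_ + _); apply: eq_bigl => h.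
have -> : (i.+2 - h = (i - h).+2)%N by have := ltn_ord h; lia.
by rewrite /= negbK.
Qed.

Lemma sum_split_zeros (V : nmodType) (D n : nat) (h : nat -> V) :
  (0 < D)%N -> h 0%N = 0 -> h D = 0 -> h n = 0 -> h (D - n)%N = 0 ->
  \sum_(j < D.+1) h j = \sum_(1 <= j < D | (j != n) && (j != D - n)%N) h j.
Proof.
move=> D_gt0 h0 hD hn hDn; rewrite -(big_mkord xpredT h) big_ltn //.
rewrite big_nat_recr //= h0 hD add0r addr0 [RHS]big_mkcond; apply: eq_bigr => j _.
by case: eqVneq => [->|_] //=; case: eqVneq => [->|_] //=; rewrite ?hn ?hDn.
Qed.

(** * Distances in a bipartite distance-regular graph *)

Section BipartiteDistanceRegular.
Variables (X : finType) (e : rel X).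
Hypothesis e_simple : connected_simple_graph e.
Hypothesis e_bip : bipartite e.
Hypothesis e_dr : distance_regular e.
Hypothesis X_gt0 : (0 < #|X|)%N.
Hypothesis D_ge4 : (4 <= diameter e)%N.

Let D_gt0 : (0 < diameter e)%N. Proof. exact: ltn_trans D_ge4. Qed.

Section Distance.
Local Open Scope nat_scope.

Local Notation dist := (gdist e).

Lemma walk_card y z :
  exists p : seq X, [/\ path e y p, last y p = z & size p < #|X|].
Proof.
have conn : connect e y z by case: e_simple.
case/connectP: conn => p pth ->.
case/shortenP: pth => p' pth' up _; exists p'; split => //.
by have := card_uniqP up; rewrite /= => <-; exact: max_card.
Qed.

Lemma gdist_walk y z :
  exists p : seq X, [/\ path e y p, last y p = z & size p = dist y z].
Proof.
rewrite /gdist; set P : pred nat := fun l => [exists p, _].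
have hasP : has P (iota 0 #|X|).
  case: (walk_card y z) => p [pth lst sz]; apply/hasP; exists (size p).
    by rewrite mem_iota.
  by apply/existsP; exists (in_tuple p); rewrite pth lst eqxx.
have := nth_find 0 hasP; rewrite nth_iota; last first.
  by move: hasP; rewrite has_find size_iota.
case/existsP => p /andP[pth /eqP lst]; exists (tval p); split => //.
by rewrite size_tuple.
Qed.

Lemma gdist_le y p : path e y p -> dist y (last y p) <= size p.
Proof.
move=> pth; rewrite leqNgt; apply/negP => lt_p.
have lt_card : dist y (last y p) <= #|X|.
  by rewrite -[X in _ <= X](size_iota 0); exact: find_size.
have := before_find 0 lt_p; rewrite nth_iota ?(leq_trans lt_p)// add0n => /existsP[].
by exists (in_tuple p); rewrite pth eqxx.
Qed.

Lemma gdistxx y : dist y y = 0.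
Proof. by apply/eqP; rewrite -leqn0; exact: (@gdist_le y [::]). Qed.

Lemma gdist_eq0 y z : (dist y z == 0) = (y == z).
Proof.
apply/eqP/eqP => [d0|->]; last exact: gdistxx.
by have [[|a p] [_ /= pl]] := gdist_walk y z; rewrite d0.
Qed.

Lemma gdist_triangle y w z : dist y z <= dist y w + dist w z.
Proof.
have [p [pth pl <-]] := gdist_walk y w; have [q [qth ql <-]] := gdist_walk w z.
rewrite -size_cat -ql -pl -last_cat; apply: gdist_le.
by rewrite cat_path pth pl.
Qed.

Lemma gdist_sym y z : dist y z = dist z y.
Proof.
suff le u w : dist u w <= dist w u by apply/eqP; rewrite eqn_leq !le.
have [p [pth <- <-]] := gdist_walk w u; case: e_simple => esym _ _.
have : path e (last w p) (rev (belast w p)).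
  by rewrite rev_path; apply: sub_path pth => a b; rewrite esym.
move/gdist_le; rewrite size_rev size_belast; congr (_ <= _).
by case: p {pth} => // a p; rewrite /= rev_cons last_rcons.
Qed.

Lemma gdist_eq1 y z : (dist y z == 1) = e y z.
Proof.
case: (e_simple) => _ irr _; apply/eqP/idP => [d1|eyz].
  have [[|w [|u p]] [/= pth pl]] := gdist_walk y z; rewrite d1 // => _.
  by rewrite -pl; case/andP: pth.
have le1 : dist y z <= 1 by apply: (@gdist_le y [:: z]); rewrite /= eyz.
have : dist y z != 0.
  by rewrite gdist_eq0; apply: contraTneq eyz => ->; rewrite irr.
by case: (dist y z) le1 => [|[]].
Qed.

Lemma gdist_step y z i :
  dist y z = i.+1 -> exists2 w, dist y w = 1 & dist w z = i.
Proof.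
move=> dyz; have [[|w p] [/= pth pl sz]] := gdist_walk y z.
  by rewrite dyz in sz.
case/andP: pth => eyw pth; have d1 : dist y w = 1.
  by apply/eqP; rewrite gdist_eq1.
exists w => //; have := gdist_le pth; have := gdist_triangle y w z.
rewrite pl d1 dyz; lia.
Qed.

Lemma gdist_le_diameter y z : dist y z <= diameter e.
Proof.
apply: leq_trans (leq_bigmax y).
exact: (@leq_bigmax _ (fun z => dist y z)).
Qed.

Lemma gdist_attained i : i <= diameter e -> exists y z, dist y z = i.
Proof.
move=> iD; have [y [z dyz]] : exists y z, dist y z = diameter e.
  have [y dy] := @bigop.eq_bigmax X (fun y => \max_z dist y z) X_gt0.
  have [z dz] := @bigop.eq_bigmax X (dist y) X_gt0.
  by exists y, z; rewrite /diameter dy dz.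
rewrite -{}dyz in iD; move: {-1}(dist y z) (erefl (dist y z)) iD => m.
elim: m y => [|m IH] y dm; first by rewrite leqn0 => /eqP ->; exists y, z.
rewrite leq_eqVlt => /orP[/eqP ->|]; first by exists y, z.
by have [w _ dw] := gdist_step dm; exact: IH dw.
Qed.

(** Crossing an edge changes the side of the bipartition. *)
Lemma gdist_parity y w z :
  odd (dist y z) = odd (dist y w) (+) odd (dist w z).
Proof.
case: e_bip => P [inP outP].
have flip u t : e u t -> (t \in P) = ~~ (u \in P).
  move=> eut; case uP : (u \in P); case tP : (t \in P) => //.
    by have := inP _ _ uP tP; rewrite eut.
  by have := outP u t; rewrite !inE uP tP eut => /(_ isT isT).
suff side u t : odd (dist u t) = (u \in P) (+) (t \in P).
  by rewrite !side; case: (y \in P); case: (z \in P); case: (w \in P).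
have [p [pth <- <-]] := gdist_walk u t.
elim: p u pth => [u _|a p IH u /= /andP[eua pth]]; first by rewrite /= addbb.
by rewrite (IH a pth) (flip _ _ eua) -addNb negbK.
Qed.

Lemma neighbour_gap y w z : dist y w = 1 ->
  dist w z = (dist y z).+1 \/ (dist w z).+1 = dist y z.
Proof.
move=> d1; have := gdist_triangle y w z; have := gdist_triangle w y z.
have := gdist_parity y w z; rewrite (gdist_sym w y) d1; lia.
Qed.

End Distance.

(** * Intersection numbers *)

Section IntersectionNumbers.

Local Notation dist := (gdist e).
Local Notation D := (diameter e).
Local Notation b := (bnum e).
Local Notation c := (cnum e).

(** Beyond the diameter both sides vanish. *)
Lemma sphere_meetE i j y z :
  sphere_meet e i j y z = intersection_number e (dist y z) i j.
Proof.
rewrite /intersection_number; case: pickP => [[y' z'] /= /eqP dE|/(_ (y, z))];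
  last by rewrite /= eqxx.
have [/andP[iD jD]|] := boolP ((i <= D) && (j <= D))%N.
  exact: (e_dr (gdist_le_diameter y z) iD jD erefl dE).
rewrite negb_and -!ltnNge => ijD.
suff empty u t : sphere_meet e i j u t = 0%N by rewrite !empty.
apply: eq_card0 => w; rewrite inE; apply/negbTE/negP => /andP[/eqP di /eqP dj].
have := gdist_le_diameter u w; have := gdist_le_diameter w t.
by rewrite di dj; case/orP: ijD; lia.
Qed.

Lemma sphere_meet1_eq0 i y z : i != (dist y z).+1 -> i.+1 != dist y z ->
  sphere_meet e 1 i y z = 0%N.
Proof.
move=> ne1 ne2; apply: eq_card0 => w; rewrite inE.
apply/negbTE/negP => /andP[/eqP d1 /eqP di].
by case: (neighbour_gap z d1); rewrite di => h; move: ne1 ne2; rewrite h eqxx.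
Qed.

Lemma bnum_gt0 i : (i < D)%N -> (0 < b i)%N.
Proof.
move=> iD; have [y [z dyz]] := gdist_attained iD.
have [w dyw dwz] := gdist_step dyz.
rewrite /bnum -dwz -sphere_meetE; apply/card_gt0P; exists y.
by rewrite inE gdist_sym // dyw dyz dwz !eqxx.
Qed.

Lemma cnum_gt0 i : (0 < i <= D)%N -> (0 < c i)%N.
Proof.
case: i => // i iD; have [y [z dyz]] := gdist_attained iD.
have [w dyw dwz] := gdist_step dyz.
rewrite /cnum -dyz -sphere_meetE; apply/card_gt0P; exists w.
by rewrite inE dyw dyz dwz !eqxx.
Qed.

Lemma cnum0 : c 0 = 0%N.
Proof.
rewrite /cnum; have [y _] := card_gt0P X_gt0.
rewrite -[X in intersection_number _ X](gdistxx y) -sphere_meetE.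
apply: eq_card0 => w; rewrite inE.
by rewrite [dist w y]gdist_sym //; case: (dist y w) => [|[]].
Qed.

Lemma cnum1 : c 1 = 1%N.
Proof.
have [y [z dyz]] := gdist_attained D_gt0.
rewrite /cnum -[X in intersection_number _ X]dyz -sphere_meetE; apply/eqP/cards1P.
exists z; apply/setP => w; rewrite !inE gdist_eq0 // andbC.
by case: eqVneq => // ->; rewrite dyz.
Qed.

Lemma degreeE y : #|[set w | dist y w == 1%N]| = b 0.
Proof.
rewrite /bnum -[X in intersection_number _ X](gdistxx y) -sphere_meetE.
apply: eq_card => w.
by rewrite !inE [dist w y]gdist_sym // andbb.
Qed.

(** A neighbour of [y] cannot be as far from [z] as [y] is. *)
Lemma bnum_add_cnum i : (i <= D)%N -> (b i + c i)%N = b 0.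
Proof.
move=> iD; have [y [z dyz]] := gdist_attained iD.
rewrite -(degreeE y) -(cardsID [set w | dist w z == i.+1]); congr (_ + _)%N.
  rewrite /bnum -[X in intersection_number _ X]dyz -sphere_meetE.
  by apply: eq_card => w; rewrite !inE.
rewrite /cnum -[X in intersection_number _ X]dyz -sphere_meetE.
apply: eq_card => w; rewrite !inE [RHS]andbC.
case: (eqVneq (dist y w) 1%N) => //= d1; have := neighbour_gap z d1; rewrite dyz; lia.
Qed.

Lemma knumE y i : #|[set w | dist y w == i]| = knum e i.
Proof.
rewrite /knum -[X in intersection_number _ X](gdistxx y) -sphere_meetE.
apply: eq_card => w.
by rewrite !inE [dist w y]gdist_sym // andbb.
Qed.

(** Both sides count the edges joining two consecutive spheres around a vertex. *)
Lemma knum_rec i : (knum e i.+1 * c i.+1 = knum e i * b i)%N.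
Proof.
have [y _] := card_gt0P X_gt0; rewrite -!(knumE y) -!sum1dep_card.
rewrite !big_distrl /=.
under eq_bigr => w /eqP dw do
  rewrite mul1n /cnum -[X in intersection_number _ X]dw gdist_sym // -sphere_meetE
    /sphere_meet -sum1dep_card.
under [RHS]eq_bigr => w /eqP dw do
  rewrite mul1n /bnum -[X in intersection_number _ X]dw gdist_sym // -sphere_meetE
    /sphere_meet -sum1dep_card.
rewrite (exchange_big_dep (fun w => dist y w == i)) /=; last first.
  by move=> w t _ /andP[_]; rewrite gdist_sym.
apply: eq_bigr => w dw; apply: eq_bigl => t.
rewrite (gdist_sym w y) dw (gdist_sym w t) andbT andbC.
by rewrite [dist t y]gdist_sym.
Qed.

Lemma knum_gt0 i : (i <= D)%N -> (0 < knum e i)%N.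
Proof.
elim: i => [|i IH] iD.
  have [y _] := card_gt0P X_gt0; rewrite -(knumE y); apply/card_gt0P; exists y.
  by rewrite inE gdistxx.
have : (0 < knum e i.+1 * c i.+1)%N.
  by rewrite knum_rec muln_gt0 bnum_gt0 // IH // ltnW.
by rewrite muln_gt0 => /andP[].
Qed.

End IntersectionNumbers.

(** * The polynomials [f_i] and their partial sums [p_i] *)

Variable R : realType.

Section Polynomials.

Local Notation D := (diameter e).
Local Notation b i := ((bnum e i)%:R : R).
Local Notation c i := ((cnum e i)%:R : R).
Local Notation kn i := ((knum e i)%:R : R).
Local Notation f i a := (fpoly R e i).[a].
Local Notation p i a := (ppoly R e i).[a].

Lemma bR_neq0 i : (i < D)%N -> b i != 0.
Proof. by move=> iD; rewrite pnatr_eq0 -lt0n bnum_gt0. Qed.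

Lemma cR_neq0 i : (0 < i <= D)%N -> c i != 0.
Proof. by move=> iD; rewrite pnatr_eq0 -lt0n cnum_gt0. Qed.

Lemma knR_neq0 i : (i <= D)%N -> kn i != 0.
Proof. by move=> iD; rewrite pnatr_eq0 -lt0n knum_gt0. Qed.

Lemma bR_add_cR i : (i <= D)%N -> b i = b 0 - c i.
Proof. by move=> iD; rewrite -(bnum_add_cnum iD) // natrD addrK. Qed.

Lemma knR_rec i : kn i.+1 * c i.+1 = kn i * b i.
Proof. by rewrite -!natrM knum_rec. Qed.

Lemma fpoly0 a : f 0 a = 1. Proof. by rewrite hornerE. Qed.

Lemma fpoly1 a : f 1 a = a.
Proof. by rewrite /= cnum1 // invr1 scale1r hornerX. Qed.

Lemma fpolySS i : fpoly R e i.+2 =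
  (c i.+2)^-1 *: ('X * fpoly R e i.+1 - b i *: fpoly R e i).
Proof. by []. Qed.

Lemma fpoly_rec i a : (i.+2 <= D)%N ->
  c i.+2 * f i.+2 a = a * f i.+1 a - b i * f i a.
Proof.
move=> iD; have c0 := @cR_neq0 i.+2 iD.
by rewrite fpolySS hornerZ mulVKf // hornerD hornerN hornerZ hornerM hornerX.
Qed.

Lemma fpoly_parity i a : f i (- a) = (-1) ^+ i * f i a.
Proof.
suff: f i (- a) = (-1) ^+ i * f i a /\ f i.+1 (- a) = (-1) ^+ i.+1 * f i.+1 a.
  by case.
elim: i => [|i [IH1 IH2]].
  by rewrite !fpoly0 /= !hornerZ !hornerX; split; ring.
split=> //; rewrite fpolySS !hornerZ !hornerD !hornerN !hornerZ !hornerM !hornerX.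
by rewrite IH1 IH2 !exprS; ring.
Qed.

Lemma size_fpoly i : (size (fpoly R e i) <= i.+1)%N.
Proof.
suff: (size (fpoly R e i) <= i.+1)%N /\ (size (fpoly R e i.+1) <= i.+2)%N by case.
elim: i => [|i [IH1 IH2]].
  split; first by rewrite size_poly1.
  by rewrite /= (leq_trans (size_scale_leq _ _)) // size_polyX.
split=> //; rewrite fpolySS (leq_trans (size_scale_leq _ _)) //.
apply: leq_trans (size_polyD _ _) _; rewrite size_polyN geq_max.
apply/andP; split.
  by apply: leq_trans (size_polyMleq _ _) _; rewrite size_polyX; exact: IH2.
apply: leq_trans (size_scale_leq _ _) _; exact: leq_trans IH1 (leqW (leqnSn _)).
Qed.

Lemma ppolyE i a : p i a = \sum_(h < i.+1 | ~~ odd (i - h)) f h a.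
Proof. by rewrite horner_sum. Qed.

Lemma ppoly0 a : p 0 a = 1.
Proof. by rewrite ppolyE big_mkcond big_ord1 /= fpoly0. Qed.

Lemma ppoly1 a : p 1 a = a.
Proof.
rewrite ppolyE big_mkcond big_ord_recr big_ord1 -[RHS]fpoly1 //.
exact: add0r.
Qed.

Lemma ppolySS i a : p i.+2 a = p i a + f i.+2 a.
Proof. by rewrite !ppolyE (same_parity_sumSS (fun h => f h a)). Qed.

Lemma ppoly_parity i a : p i (- a) = (-1) ^+ i * p i a.
Proof.
rewrite !ppolyE mulr_sumr; apply: eq_bigr => h odd_ih; rewrite fpoly_parity.
have := ltn_ord h; rewrite ltnS => hi.
congr (_ * _); rewrite -[in RHS](subnK hi) exprD.
by rewrite -[_ ^+ (i - h)]signr_odd (negbTE odd_ih) mul1r.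
Qed.

Lemma size_ppoly i : (size (ppoly R e i) <= i.+1)%N.
Proof.
apply: (big_ind (fun q : {poly R} => size q <= i.+1)%N); first by rewrite size_poly0.
  by move=> q r hq hr; rewrite (leq_trans (size_polyD _ _)) // geq_max hq.
by move=> h _; rewrite (leq_trans (size_fpoly h)).
Qed.

Lemma ppoly_rec i a : (i.+2 <= D)%N ->
  a * p i.+1 a = c i.+2 * p i.+2 a + b i.+2 * p i a.
Proof.
have bcE := bR_add_cR.
elim/ltn_ind: i => -[|[|i]] IH iD.
- rewrite ppolySS mulrDr fpoly_rec // ppoly1 // ppoly0 fpoly0 fpoly1 // (bcE _ iD).
  by ring.
- rewrite !ppolySS mulrDr [in RHS]mulrDr (fpoly_rec _ iD) ppoly0 ppoly1 //.
  by rewrite fpoly1 // (bcE _ iD) (bcE _ D_gt0) cnum1 //; ring.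
have iD2 : (i.+2 <= D)%N by lia.
rewrite [p i.+3 a]ppolySS [p i.+4 a]ppolySS !mulrDr (fpoly_rec _ iD) IH //.
by rewrite [p i.+2 a]ppolySS (bcE _ iD) (bcE _ iD2); ring.
Qed.

(** The multiplier [k^2 - a^2] turns each partial sum [p i] into a combination
    of [f i] and [f i.+2] alone, so that [p i] inherits from the distance
    matrices an orthogonality with weight [k^2 - a^2]. *)
Lemma ppoly_weighted i a : (i.+2 <= D)%N ->
  (b 0 ^+ 2 - a ^+ 2) * p i a =
  b i * b i.+1 * f i a - c i.+1 * c i.+2 * f i.+2 a.
Proof.
move=> iD; have bcE := bR_add_cR.
(* Applying the recurrence twice; [p i a - f i a] stands for [p (i - 2) a], so
   that [i = 0] and [i = 1] are covered as well. *)
have two_step : a ^+ 2 * p i a = c i.+1 * (c i.+2 * p i.+2 a + b i.+2 * p i a)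
    + b i.+1 * (c i * p i a + b i * (p i a - f i a)).
  rewrite expr2 -mulrA; case: i iD => [|[|i]] iD.
  - rewrite -(ppoly_rec a iD) ppoly0 ppoly1 // fpoly0 cnum0 // cnum1 //.
    by ring.
  - rewrite -(ppoly_rec a iD) (ppoly_rec a (ltnW iD)) ppoly0 ppoly1 // fpoly1 //.
    by rewrite cnum1 //; ring.
  rewrite -(ppoly_rec a iD) (ppoly_rec a (ltnW iD)) mulrDr.
  rewrite [a * (b _ * _)]mulrCA (ppoly_rec a (ltnW (ltnW iD))) [p i.+2 a]ppolySS.
  by ring.
have cE : c i = b 0 - b i by rewrite (bcE i) ?subKr //; lia.
rewrite mulrBl two_step ppolySS cE (bcE _ iD) (bcE _ (ltnW iD)); ring.
Qed.

End Polynomials.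

(** * Distance matrices *)

Section DistanceMatrices.

Local Notation dist := (gdist e).
Local Notation D := (diameter e).
Local Notation b := (bnum e).
Local Notation c := (cnum e).
Local Notation A := (adj_mx R e).
Local Notation Ad := (dist_mx R e).

Lemma sum_enum_val (V : nmodType) (F : X -> V) :
  \sum_(y < #|X|) F (enum_val y) = \sum_y F y.
Proof. by rewrite -big_enum_val. Qed.

Lemma dist_mx_tr i : (Ad i)^T = Ad i.
Proof. by apply/matrixP => y z; rewrite !mxE gdist_sym. Qed.

Lemma dist_mx_mulE i j y z : (Ad i *m Ad j) y z =
  (sphere_meet e i j (enum_val y) (enum_val z))%:R.
Proof.
rewrite mxE /sphere_meet -sum1dep_card natr_sum [RHS]big_mkcond -[RHS]sum_enum_val.
apply: eq_bigr => w _; rewrite !mxE -natrM mulnb.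
by case: (_ && _).
Qed.

Lemma dist_mx0 : Ad 0 = 1%:M.
Proof.
apply/matrixP => y z; rewrite !mxE gdist_eq0 //.
by rewrite (inj_eq enum_val_inj).
Qed.

Lemma dist_mx_gt i : (D < i)%N -> Ad i = 0.
Proof.
move=> iD; apply/matrixP => y z; rewrite !mxE; case: eqP => // dyz.
by have := gdist_le_diameter (enum_val y) (enum_val z); rewrite dyz leqNgt iD.
Qed.

(** There is no term in [A_(i+1)] because the graph is bipartite. *)
Lemma adj_dist_mxS i :
  A *m Ad i.+1 = (b i)%:R *: Ad i + (c i.+2)%:R *: Ad i.+2.
Proof.
apply/matrixP => y z; rewrite dist_mx_mulE !mxE.
set u := enum_val y; set w := enum_val z; rewrite sphere_meetE //.
case: (eqVneq (dist u w) i) => [->|ne1].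
  by rewrite ltn_eqF // mulr1 mulr0 addr0.
case: (eqVneq (dist u w) i.+2) => [->|ne2].
  by rewrite mulr1 mulr0 add0r.
by rewrite -sphere_meetE // sphere_meet1_eq0 ?mulr0 ?addr0 1?eq_sym //.
Qed.

(** This is the identity [A_i = f_i(A)], tested on eigenvectors. *)
Lemma dist_mx_eigen m (w : 'M_(_, m)) (a : R) i : (i <= D)%N ->
  A *m w = a%:C *: w -> Ad i *m w = ((fpoly R e i).[a])%:C *: w.
Proof.
move=> + Aw.
suff: ((i <= D)%N -> Ad i *m w = ((fpoly R e i).[a])%:C *: w) /\
   ((i < D)%N -> Ad i.+1 *m w = ((fpoly R e i.+1).[a])%:C *: w) by case.
elim: i => [|i [IH1 IH2]].
  by rewrite dist_mx0 mul1mx fpoly0 scale1r fpoly1 //; split.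
split=> // iD; have c0 : (c i.+2)%:R != 0 :> R[i].
  by rewrite pnatr_eq0 -lt0n cnum_gt0.
apply: (scalerI c0); rewrite scalerA -[_%:R](rmorph_nat (real_complex R)).
rewrite -rmorphM /= fpoly_rec // scalemxAl.
have -> : (c i.+2)%:R%:C *: Ad i.+2 = A *m Ad i.+1 - (b i)%:R *: Ad i.
  by rewrite adj_dist_mxS addrC addKr rmorph_nat.
rewrite mulmxBl -mulmxA IH2 1?ltnW // -scalemxAr Aw -scalemxAl IH1; last by lia.
by rewrite !scalerA -scalerBl rmorphB !rmorphM rmorph_nat mulrC.
Qed.

End DistanceMatrices.

(** * The spectrum *)

Section Spectrum.
Variable theta : nat -> R.
Hypothesis theta_eig : ordered_eigenvalues e (diameter e) theta.

Local Notation dist := (gdist e).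
Local Notation D := (diameter e).
Local Notation b i := ((bnum e i)%:R : R).
Local Notation c i := ((cnum e i)%:R : R).
Local Notation A := (adj_mx R e).
Local Notation Ad := (dist_mx R e).
Local Notation E j := (prim_idem e (theta j)%:C).
Local Notation f i a := (fpoly R e i).[a].
Local Notation p i a := (ppoly R e i).[a].

Lemma theta_lt i j : (i < j <= D)%N -> theta j < theta i.
Proof. by case: theta_eig => h _; exact: h. Qed.

Lemma theta_inj i j : (i <= D)%N -> (j <= D)%N -> (theta i == theta j) = (i == j).
Proof.
move=> iD jD; case: (ltngtP i j) => [ij|ji|->]; last exact: eqxx.
  by rewrite gt_eqF // theta_lt ?ij.
by rewrite lt_eqF // theta_lt ?ji.
Qed.

Lemma theta_eigenvalue j : (j <= D)%N -> eigenvalue A (theta j)%:C.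
Proof. by move=> jD; case: theta_eig => _ h; apply/h; exists j. Qed.

Lemma adj_tr : A^T = A. Proof. exact: dist_mx_tr. Qed.

Lemma adj_real : A \is a mxOver Num.real.
Proof. by apply/mxOverP => y z; rewrite mxE; exact: realn. Qed.

Lemma real_complex_real (a : R) : a%:C \is Num.real.
Proof. by apply/complex_realP; exists a. Qed.

Lemma complexR_inj : injective (real_complex R).
Proof. exact: fmorph_inj. Qed.

Lemma prim_idem_mul i j : (i <= D)%N -> (j <= D)%N ->
  E i *m E j = if i == j then E i else 0.
Proof.
move=> iD jD; rewrite /prim_idem -trmx_mul adj_tr.
rewrite (eigenproj_mul adj_tr adj_real) ?real_complex_real //.
by rewrite (inj_eq complexR_inj) theta_inj // eq_sym; case: (_ == _); rewrite ?trmx0.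
Qed.

Lemma sum_prim_idem : \sum_(j < D.+1) E j = 1%:M.
Proof.
have := @sum_eigenproj _ _ _ adj_tr adj_real
  [seq (theta j)%:C | j <- index_iota 0 D.+1].
rewrite big_map big_mkord => sumE.
apply: trmx_inj; rewrite trmx1 -sumE.
- by rewrite raddf_sum; apply: eq_bigr => j _; rewrite /= trmxK adj_tr.
- rewrite map_inj_in_uniq ?iota_uniq // => i j; rewrite !mem_index_iota !ltnS.
  by move=> iD jD /complexR_inj/eqP; rewrite theta_inj // => /eqP.
- by apply/allP => _ /mapP[j _ ->]; exact: real_complex_real.
move=> a; case: theta_eig => _ h /h[j jD ->]; apply/mapP; exists j => //.
by rewrite mem_index_iota ltnS.
Qed.

Lemma adj_prim_idem j : A *m E j = (theta j)%:C *: E j.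
Proof.
apply: trmx_inj; rewrite trmx_mul linearZ /= trmxK !adj_tr.
exact: mul_eigenproj.
Qed.

Lemma prim_idem_adj j : (j <= D)%N -> E j *m A = (theta j)%:C *: E j.
Proof.
move=> jD; rewrite -[LHS]mulmx1 -sum_prim_idem mulmx_sumr.
have termE (i : 'I_D.+1) : E j *m A *m E i =
    if j == i then (theta j)%:C *: E j else 0.
  rewrite -mulmxA adj_prim_idem -scalemxAr prim_idem_mul ?leq_ord //.
  by case: eqP => [->|_] //; rewrite scaler0.
under eq_bigr do rewrite termE.
by rewrite -big_mkcond (big_pred1 (Ordinal (jD : (j < D.+1)%N))).
Qed.

Lemma prim_idem_trace_gt0 j : (j <= D)%N -> 0 < \tr (E j).
Proof.
move=> jD; rewrite mxtrace_tr adj_tr.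
exact: eigenproj_trace_gt0 (theta_eigenvalue jD).
Qed.

Lemma prim_idem_neq0 j : (j <= D)%N -> E j != 0.
Proof.
by move=> /prim_idem_trace_gt0; apply: contraTneq => ->; rewrite mxtrace0 ltxx.
Qed.

Lemma dist_prim_idem i j : (i <= D)%N ->
  Ad i *m E j = (f i (theta j))%:C *: E j.
Proof. by move=> iD; apply: dist_mx_eigen => //; exact: adj_prim_idem. Qed.

Lemma prim_idem_dist i j : (i <= D)%N -> (j <= D)%N ->
  E j *m Ad i = (f i (theta j))%:C *: E j.
Proof.
move=> iD jD; apply: trmx_inj; rewrite trmx_mul dist_mx_tr // linearZ /=.
apply: dist_mx_eigen => //.
by rewrite -[A]adj_tr -trmx_mul prim_idem_adj // linearZ.
Qed.

Lemma sign_dist y w z : (-1) ^+ dist y z = (-1) ^+ dist y w * (-1) ^+ dist w z :> R[i].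
Proof.
rewrite -[LHS]signr_odd (gdist_parity y w z) signr_addb.
by rewrite !signr_odd.
Qed.

Lemma eigenvalue_opp a : eigenvalue A a -> eigenvalue A (- a).
Proof.
case/eigenvalueP => v vA v0; have [x _] := card_gt0P X_gt0.
pose s (y : 'I_#|X|) : R[i] := (-1) ^+ dist x (enum_val y).
have s2 y : s y * s y = 1 by rewrite -expr2 sqrr_sign.
apply/eigenvalueP; exists (\row_y (s y * v 0 y)).
  apply/rowP => z; rewrite !mxE mulNr mulrCA.
  have -> : a * v 0 z = (v *m A) 0 z by rewrite vA mxE.
  rewrite mxE mulr_sumr -sumrN; apply: eq_bigr => y _; rewrite !mxE.
  case: eqP => [d1|_]; last by rewrite !mulr0 oppr0.
  by rewrite /s (sign_dist x (enum_val y) (enum_val z)) d1; ring.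
apply: contraNneq v0 => /rowP sv0; apply/eqP/rowP => y; rewrite mxE.
by have := sv0 y; rewrite !mxE => /(congr1 ( *%R (s y))); rewrite mulrA s2 mul1r mulr0.
Qed.

Lemma theta_leq i j : (i <= D)%N -> theta j < theta i -> (i < j)%N.
Proof.
move=> iD; apply: contraTT; rewrite -leqNgt leq_eqVlt -leNgt.
by case/orP => [/eqP -> //|ji]; rewrite ltW // theta_lt ?ji.
Qed.

Lemma theta_index a : eigenvalue A a%:C -> exists2 j, (j <= D)%N & theta j = a.
Proof.
by case: theta_eig => _ h /h[j jD /complexR_inj ->]; exists j.
Qed.

Lemma theta_opp_index i : (i <= D)%N -> exists2 m, (m <= D)%N & theta m = - theta i.
Proof.
move=> iD; apply: theta_index; rewrite rmorphN /=.
exact/eigenvalue_opp/theta_eigenvalue.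
Qed.

(** Negation permutes the eigenvalues and reverses their order, and there is
    only one order-reversing permutation of [0, ..., D]. *)
Lemma theta_opp i : (i <= D)%N -> theta (D - i) = - theta i.
Proof.
have upper j m : (j <= D)%N -> (m <= D)%N -> theta m = - theta j -> (j + m <= D)%N.
  elim: j m => // j IH m jD mD tm; have [m' m'D tm'] := theta_opp_index (ltnW jD).
  have := IH m' (ltnW jD) m'D tm'.
  have : (m < m')%N.
    by apply: (theta_leq mD); rewrite tm tm' ltrN2 theta_lt ?ltnSn.
  lia.
have lower j m : (j <= D)%N -> (m <= D)%N -> theta m = - theta (D - j) -> (j <= m)%N.
  elim: j m => // j IH m jD mD tm.
  have [m' m'D tm'] := theta_opp_index (leq_subr j D).
  have := IH m' (ltnW jD) m'D tm'.
  have : (m' < m)%N.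
    by apply: (theta_leq m'D); rewrite tm tm' ltrN2 theta_lt //; lia.
  lia.
move=> iD; have [m mD tm] := theta_opp_index iD.
have := upper _ _ iD mD tm.
have := lower (D - i)%N m (leq_subr _ _) mD; rewrite subKn // => /(_ tm) le1 le2.
by rewrite (_ : (D - i = m)%N) //; lia.
Qed.

Local Notation J := (const_mx 1 : 'M[R[i]]_#|X|).

Lemma ones_adj : J *m A = (b 0)%:C *: J.
Proof.
apply/matrixP => y z; rewrite !mxE mulr1 rmorph_nat -(degreeE (enum_val z)).
rewrite -sum1dep_card natr_sum [RHS]big_mkcond -[RHS]sum_enum_val.
by apply: eq_bigr => w _; rewrite !mxE mul1r gdist_sym //; case: eqP.
Qed.

Lemma adj_ones : A *m J = (b 0)%:C *: J.
Proof. by apply: trmx_inj; rewrite trmx_mul adj_tr linearZ /= trmx_const ones_adj. Qed.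

Lemma valency_index : exists2 j, (j <= D)%N & theta j = b 0.
Proof.
have [x _] := card_gt0P X_gt0.
apply/theta_index/eigenvalueP; exists (row (enum_rank x) J).
  by rewrite -row_mul ones_adj linearZ.
apply/eqP => /rowP/(_ (enum_rank x)).
by rewrite !mxE => /eqP; rewrite oner_eq0.
Qed.

Local Notation F a := (\sum_(i < D.+1) f i a).

(** The two choices of the sign give the matrix [J] and its alternating
    counterpart, of eigenvalues [k] and [- k]. *)
Lemma ones_signE (s : bool) :
  \matrix_(y, z) ((-1) ^+ s) ^+ dist (enum_val y) (enum_val z) =
  \sum_(i < D.+1) ((-1) ^+ s) ^+ i *: Ad i :> 'M[R[i]]_#|X|.
Proof.
apply/matrixP => y z; rewrite summxE mxE.
have dD : (dist (enum_val y) (enum_val z) < D.+1)%N by rewrite ltnS gdist_le_diameter.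
rewrite (bigD1 (Ordinal dD)) //= !mxE eqxx mulr1 big1 ?addr0 // => i.
rewrite -val_eqE /= !mxE eq_sym => /negbTE ->; exact: mulr0.
Qed.

Lemma prim_idem_ones_sign (s : bool) j : (j <= D)%N ->
  E j *m \matrix_(y, z) ((-1) ^+ s) ^+ dist (enum_val y) (enum_val z) =
  (F ((-1) ^+ s * theta j))%:C *: E j.
Proof.
move=> jD; rewrite ones_signE mulmx_sumr rmorph_sum scaler_suml.
apply: eq_bigr => i _; have iD : (i <= D)%N by rewrite leq_ord.
rewrite -scalemxAr prim_idem_dist // scalerA; congr (_ *: _).
case: s; last by rewrite !expr0 expr1n !mul1r.
by rewrite expr1 mulN1r fpoly_parity rmorphM rmorphXn rmorphN1.
Qed.

Lemma prim_idem_ones j : (j <= D)%N -> E j *m J = (F (theta j))%:C *: E j.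
Proof.
move=> jD; have := prim_idem_ones_sign false jD; rewrite expr0 mul1r => <-.
by congr (_ *m _); apply/matrixP => y z; rewrite !mxE expr1n.
Qed.

(** From [k] on, [c_(j+1) f_(j+1)] dominates [b_j f_j], by induction along the
    recurrence. *)
Lemma fpoly_gt0 i a : b 0 <= a -> (i <= D)%N -> 0 < f i a.
Proof.
move=> ka.
have bR_gt0 j : (j < D)%N -> 0 < b j by move=> jD; rewrite ltr0n bnum_gt0.
have cR_gt0 j : (0 < j <= D)%N -> 0 < c j by move=> jD; rewrite ltr0n cnum_gt0.
have up j : (j < D)%N -> 0 < f j a -> b j * f j a <= c j.+1 * f j.+1 a ->
    0 < f j.+1 a.
  move=> jD fj le_f; rewrite -(pmulr_rgt0 _ (cR_gt0 j.+1 jD)).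
  by apply: lt_le_trans le_f; rewrite mulr_gt0 ?bR_gt0.
suff main j : (j < D)%N -> 0 < f j a /\ b j * f j a <= c j.+1 * f j.+1 a.
  case: i => [|i] iD; first by rewrite fpoly0.
  by case: (main i iD) => fi le_f; exact: up.
elim: j => [|j IH] jD.
  by rewrite fpoly0 fpoly1 // cnum1 mul1r mulr1.
have [fj le_f] := IH (ltnW jD); have fj1 := up j (ltnW jD) fj le_f; split=> //.
rewrite fpoly_rec // bR_add_cR //; last exact: ltnW.
rewrite mulrBl lerB // ler_wpM2r // ltW //.
Qed.

(** An eigenvector for an eigenvalue other than [k] is orthogonal to the
    all-ones vector, hence killed by [J = A_0 + ... + A_D]. *)
Lemma sum_fpoly_eq0 j : (j <= D)%N -> theta j != b 0 -> F (theta j) = 0.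
Proof.
move=> jD neq.
have: (theta j - b 0)%:C *: (E j *m J) = 0.
  rewrite rmorphB scalerBl scalemxAl -prim_idem_adj // -mulmxA adj_ones.
  by rewrite -scalemxAr subrr.
move/eqP; rewrite scaler_eq0 fmorph_eq0 subr_eq0 (negbTE neq) /= prim_idem_ones //.
by rewrite scaler_eq0 fmorph_eq0 (negbTE (prim_idem_neq0 jD)) orbF => /eqP.
Qed.

Lemma sum_fpoly_gt0 a : b 0 <= a -> 0 < F a.
Proof.
move=> ka; rewrite (bigD1 ord0) //; apply: ltr_wpDr; last exact: fpoly_gt0.
by apply: sumr_ge0 => i _; rewrite ltW // fpoly_gt0 // leq_ord.
Qed.

(** The sum of the [f_i] vanishes at every eigenvalue other than [k], but is
    positive from [k] on, so no eigenvalue exceeds [k]. *)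
Lemma theta0 : theta 0 = b 0.
Proof.
have [j jD tj] := valency_index; apply/eqP; apply: contraT => neq.
have k_lt : b 0 < theta 0.
  rewrite lt_neqAle eq_sym neq -tj; case: j jD {tj} => [|j] jD; first by rewrite lexx.
  by rewrite ltW // theta_lt.
by have := sum_fpoly_gt0 (ltW k_lt); rewrite (sum_fpoly_eq0 _ neq) // ltxx.
Qed.

Lemma sum_fpoly_ppoly i a : \sum_(h < i.+2) f h a = p i.+1 a + p i a.
Proof.
elim: i => [|i IH].
  rewrite big_ord_recr big_ord1 /= -/(fpoly R e 1) -/(fpoly R e 0).
  by rewrite fpoly0 fpoly1 ppoly0 ppoly1 addrC.
by rewrite big_ord_recr IH [p i.+2 a]ppolySS addrAC; congr (_ + _); rewrite addrC.
Qed.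

(** The sums over all distances at [theta_j] and at [- theta_j] vanish
    together, so their parts of the two parities vanish separately. *)
Lemma ppoly_pred_diameter j : (0 < j < D)%N -> p D.-1 (theta j) = 0.
Proof.
case/andP => j0 jD; have jD' := ltnW jD.
have neq0 m : (0 < m <= D)%N -> theta m != b 0.
  by case/andP => m0 mD; rewrite -theta0 theta_inj // -lt0n.
have FE m a : (0 < m)%N -> \sum_(h < m.+1) f h a = p m a + p m.-1 a.
  by case: m => // m _; exact: sum_fpoly_ppoly.
have h1 : F (theta j) = 0 by apply/(sum_fpoly_eq0 jD')/neq0; rewrite j0.
have h2 : F (- theta j) = 0.
  rewrite -theta_opp //; apply/sum_fpoly_eq0/neq0; lia.
have sgnD : (-1) ^+ D = - (-1) ^+ D.-1 :> R by rewrite -{1}(prednK D_gt0) exprS mulN1r.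
move: h1 h2; rewrite !FE // !ppoly_parity sgnD -signr_odd.
by case: (odd _); rewrite ?expr0 ?expr1; lra.
Qed.

Lemma theta_sqr_lt j : (0 < j < D)%N -> theta j ^+ 2 < b 0 ^+ 2.
Proof.
case/andP => j0 jD; have t1 : theta j < b 0 by rewrite -theta0 theta_lt // j0 ltnW.
have t2 : - b 0 < theta j by rewrite -theta0 -theta_opp // subn0 theta_lt // jD leqnn.
nra.
Qed.

(** * Orthogonality of the [p_i], and their values at extremal eigenvalues *)

Local Notation Phi q := (\sum_(j < D.+1) (q.[theta j])%:C *: E j).

(** [Phi q] is the matrix [q(A)], and an entry of [A ^ m] counts walks of
    length [m]. *)
Lemma polyfun_support (q : {poly R}) i y z : (size q <= i)%N ->
  (i <= dist (enum_val y) (enum_val z))%N -> Phi q y z = 0.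
Proof.
elim/poly_ind: q i y z => [|q a IH] i y z.
  by move=> _ _; rewrite big1 ?mxE // => j _; rewrite horner0 scale0r.
rewrite size_MXaddC; case: ifP => [/andP[/eqP -> /eqP ->] _ _|_].
  by rewrite big1 ?mxE // => j _; rewrite mul0r add0r hornerC scale0r.
case: i => // i; rewrite ltnS => qi i_lt.
have -> : Phi (q * 'X + a%:P) = Phi q *m A + a%:C *: 1%:M.
  rewrite -sum_prim_idem scaler_sumr mulmx_suml -big_split /=.
  apply: eq_bigr => j _; rewrite -scalemxAl prim_idem_adj ?leq_ord // scalerA.
  by rewrite -scalerDl !hornerE rmorphD rmorphM.
rewrite !mxE big1 => [|w _].
  rewrite add0r; case: eqVneq (i_lt) => [->|]; last by rewrite mulr0.
  by rewrite gdistxx.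
rewrite !mxE; case: eqP => [d1|_]; last exact: mulr0.
rewrite (IH i y w) ?mul0r //.
have := gdist_triangle (enum_val y) (enum_val w) (enum_val z).
by rewrite d1 addn1; exact: leq_trans i_lt.
Qed.

(** Discrete orthogonality: [tr (A_i q(A))] only sees pairs of vertices at
    distance [i], which are out of reach of walks of length below [i]. *)
Lemma fpoly_ortho i (q : {poly R}) : (size q <= i <= D)%N ->
  \sum_(j < D.+1) (f i (theta j) * q.[theta j])%:C * \tr (E j) = 0.
Proof.
case/andP => qi iD.
have -> : \sum_(j < D.+1) (f i (theta j) * q.[theta j])%:C * \tr (E j) =
    \tr (Ad i *m Phi q).
  rewrite mulmx_sumr raddf_sum; apply: eq_bigr => j _ /=.
  by rewrite -scalemxAr dist_prim_idem // scalerA linearZ /= rmorphM [X in X * _]mulrC.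
rewrite /mxtrace big1 // => y _; rewrite mxE big1 // => z _.
rewrite !mxE; case: eqP => [dyz|_]; last by rewrite mul0r.
by rewrite (polyfun_support qi) ?mulr0 // gdist_sym // dyz.
Qed.

Lemma ppoly_ortho i (q : {poly R}) : (size q <= i)%N -> (i.+2 <= D)%N ->
  \sum_(j < D.+1)
    ((b 0 ^+ 2 - theta j ^+ 2) * p i (theta j) * q.[theta j])%:C * \tr (E j) = 0.
Proof.
move=> qi iD.
transitivity (\sum_(j < D.+1)
   ((b i * b i.+1)%:C * ((f i (theta j) * q.[theta j])%:C * \tr (E j)) -
   (c i.+1 * c i.+2)%:C * ((f i.+2 (theta j) * q.[theta j])%:C * \tr (E j)))).
  apply: eq_bigr => j _; rewrite ppoly_weighted // !mulrA -!rmorphM -mulrBl -rmorphB.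
  by congr (_%:C * _); ring.
rewrite sumrB -!mulr_sumr !fpoly_ortho ?mulr0 ?subrr //.
  by rewrite (leq_trans qi) // ltnW.
by rewrite qi /= ltnW // ltnW.
Qed.

Lemma ppoly_neq0 i : (i <= D)%N -> ppoly R e i != 0.
Proof.
move=> iD; apply/eqP => p0; have: 0 < p i (b 0).
  rewrite ppolyE big_mkcond big_ord_recr /= subnn.
  apply: ltr_wpDl; last exact: fpoly_gt0.
  apply: sumr_ge0 => h _; case: ifP => // _.
  by rewrite ltW // fpoly_gt0 //; have := ltn_ord h; lia.
by rewrite p0 horner0 ltxx.
Qed.

(** If [p i] vanished at [+-t] with [q] the quotient by [X^2 - t^2], the
    weighted orthogonality of [p i] to [q] would read
    [sum_j (k^2 - theta_j^2) (theta_j^2 - t^2) q(theta_j)^2 tr E_j = 0].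
    When [t^2] is extremal among the [theta_j^2], all terms have the same
    sign, so [p i] would vanish at the [D - 1] points [theta_j]. *)
Lemma ppoly_extremal_neq0 i (t s : R) : (i.+2 <= D)%N -> t != 0 -> s != 0 ->
  (forall j, (0 < j < D)%N -> 0 <= s * (theta j ^+ 2 - t ^+ 2)) -> p i t != 0.
Proof.
move=> iD t0 s0 ext; apply/eqP => pt0.
have pNt0 : p i (- t) = 0 by rewrite ppoly_parity pt0 mulr0.
have [q pE] : exists q, ppoly R e i = q * ('X^2 - (t ^+ 2)%:P).
  have [q1 p1E] := factor_theorem _ _ (introT eqP pt0).
  have : root q1 (- t).
    have := pNt0; rewrite p1E hornerM hornerXsubC => /eqP; rewrite mulf_eq0.
    by case/orP => // /eqP tt; case/eqP: t0; lra.
  case/factor_theorem => q q1E; exists q; rewrite p1E q1E -mulrA; congr (_ * _).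
  by rewrite rmorphN rmorphXn /=; ring.
have pval a : p i a = q.[a] * (a ^+ 2 - t ^+ 2) by rewrite pE !hornerE.
have p_neq0 : ppoly R e i != 0 by apply: ppoly_neq0; lia.
have q_neq0 : q != 0 by apply: contraNneq p_neq0 => q0; rewrite pE q0 mul0r.
have size_q : (size q <= i)%N.
  have := size_ppoly i; rewrite pE size_Mmonic // ?monicXnsubC //.
  by rewrite size_XnsubC // addn3 /= !ltnS => /ltnW.
pose w j := s * (theta j ^+ 2 - t ^+ 2) * (b 0 ^+ 2 - theta j ^+ 2) * q.[theta j] ^+ 2.
have w_ge0 j : (j <= D)%N -> 0 <= w j.
  move=> jD; have [j_in|] := boolP (0 < j < D)%N.
    rewrite /w mulr_ge0 ?sqr_ge0 // mulr_ge0 ?ext // subr_ge0.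
    by rewrite ltW ?theta_sqr_lt.
  (* At both ends the factor [k^2 - theta_j^2] vanishes. *)
  have kk : theta D ^+ 2 = b 0 ^+ 2.
    by rewrite -[D in LHS]subn0 theta_opp // theta0 sqrrN.
  rewrite negb_and -leqNgt leqn0 -leqNgt => /orP[/eqP ->|Dj].
    by rewrite /w theta0 subrr mulr0 mul0r.
  by rewrite /w (_ : j = D) ?kk ?subrr ?mulr0 ?mul0r //; apply/eqP; rewrite eqn_leq jD.
have w_sum : \sum_(j < D.+1) (w j)%:C * \tr (E j) = 0.
  have := congr1 ( *%R s%:C) (ppoly_ortho size_q iD).
  rewrite mulr0 big_distrr /= => sum0; rewrite -[RHS]sum0.
  apply: eq_bigr => j _; rewrite mulrA -rmorphM; congr (_%:C * _).
  by rewrite /w pval; ring.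
have w0 j : (j <= D)%N -> w j = 0.
  move=> jD; move/eqP: w_sum; rewrite psumr_eq0 => [/allP|m _]; last first.
    by rewrite mulr_ge0 ?ler0c ?w_ge0 ?leq_ord // ltW // prim_idem_trace_gt0 // leq_ord.
  move=> /(_ (inord j) (mem_index_enum _)) /=; rewrite inordK // mulf_eq0.
  by rewrite (gt_eqF (prim_idem_trace_gt0 _)) // orbF fmorph_eq0 => /eqP.
have: (size [seq theta j | j <- index_iota 1 D] < size (ppoly R e i))%N.
  apply: max_poly_roots => //.
    apply/allP => _ /mapP[j + ->]; rewrite mem_index_iota => j_in.
    have jD : (j <= D)%N by case/andP: j_in => _ /ltnW.
    rewrite /root pval mulf_eq0; have /eqP := w0 j jD.
    rewrite /w mulf_eq0 sqrf_eq0 !mulf_eq0 (negbTE s0).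
    by rewrite [b 0 ^+ 2 - _ == _]subr_eq0 (gt_eqF (theta_sqr_lt j_in)) orbF orbC.
  rewrite map_inj_in_uniq ?iota_uniq // => j m; rewrite !mem_index_iota => j_in m_in.
  move/eqP; rewrite theta_inj; first by move/eqP.
    by case/andP: j_in => _ /ltnW.
  by case/andP: m_in => _ /ltnW.
rewrite size_map size_iota ltnNge (leq_trans (size_ppoly i)) //; lia.
Qed.

(** The two choices of [n] are those for which [theta n ^ 2] is largest, or
    smallest and positive, among the squares of the middle eigenvalues. *)
Lemma ppoly_theta_neq0 i n :
  (if odd D then (n = 1%N) \/ (n = D./2) else n = 1%N) ->
  (i.+2 <= D)%N -> p i (theta n) != 0.
Proof.
move=> n_cond iD.
have n_half : (n.*2 < D)%N /\ (0 < n)%N by case: ifP n_cond => oD; lia.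
have tn_gt0 : 0 < theta n.
  have : theta (D - n) < theta n by apply: theta_lt; lia.
  rewrite theta_opp; last by lia.
  lra.
have mono j m : (j <= m)%N -> (m <= D)%N -> theta m <= theta j.
  by rewrite leq_eqVlt => /orP[/eqP -> //|jm mD]; rewrite ltW // theta_lt ?jm.
have n1 : n = 1%N -> p i (theta n) != 0.
  move=> n1; apply: (@ppoly_extremal_neq0 i _ (-1)) => //.
  - by rewrite gt_eqF.
  - by rewrite oppr_eq0 oner_eq0.
  move=> j /andP[j0 jD].
  have : theta j <= theta n by rewrite n1; apply: mono => //; exact: ltnW.
  have : - theta n <= theta j by rewrite n1 -theta_opp; [apply: mono|]; lia.
  nra.
case: ifP n_cond => oD; last exact: n1.
case=> [/n1 //|nd]; apply: (@ppoly_extremal_neq0 i _ 1) => //.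
- by rewrite gt_eqF.
- by rewrite oner_eq0.
move=> j /andP[j0 jD]; case: (leqP j n) => jn.
  have : theta n <= theta j by apply: mono; lia.
  nra.
have : theta j <= - theta n by rewrite -theta_opp; [apply: mono|]; lia.
nra.
Qed.

End Spectrum.

(** * Kernel polynomials *)

Section KernelPolynomials.
Variable t : R.
Hypothesis p_neq0 : forall i, (i.+2 <= diameter e)%N -> (ppoly R e i).[t] != 0.

Local Notation D := (diameter e).
Local Notation b i := ((bnum e i)%:R : R).
Local Notation c i := ((cnum e i)%:R : R).
Local Notation p i a := (ppoly R e i).[a].
Local Notation P i := (ppoly R e i).[t].

Let c1 : c 1 = 1. Proof. by rewrite cnum1. Qed.

Let bc_sum i j : (i <= D)%N -> (j <= D)%N -> b i = b j + c j - c i.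
Proof. by move=> iD jD; rewrite (bR_add_cR jD) // subrK -bR_add_cR. Qed.

(** The solution of the relations found below for a thin module whose local
    eigenvalue is [mid_coef 0]: with [v_i = E*_{i+2} A_i v], these are the
    scalars of [E*_{i+2} A_{i+2} v], of the raised [E*_{i+1} A_{i+1} v] and of
    the lowered [v_{i+1}] relative to [v_i].  Since [raise_coef (i + 1)] is
    [c_{i+1} mid_coef i], the middle one is a shift of the first; it is written
    so as to make sense at [i = 0] too. *)
Definition mid_coef i : R :=
  - 1 - b i.+2 * b i.+3 * P i / (c i.+2 * c i.+1 * P i.+2).
Definition raise_coef i : R :=
  - c i - b i.+2 * (t * P i / (c i.+1 * P i.+1) - 1).
Definition lower_coef i : R :=
  b i.+2 * c i.+3 * P i * P i.+3 / (c i.+1 * P i.+1 * P i.+2).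

Lemma mid_coef0 : mid_coef 0 = - 1 - b 2 * b 3 / (t ^+ 2 - b 2).
Proof.
rewrite /mid_coef ppoly0 c1 !mulr1; congr (_ - _ / _).
have := ppoly_rec t (ltnW (ltnW D_ge4)).
by rewrite ppoly0 ppoly1; lra.
Qed.

Lemma raise_coef0 : raise_coef 0 = 0.
Proof.
have P1 := p_neq0 (ltnW D_ge4); rewrite /raise_coef cnum0 // ppoly0.
move: P1; rewrite ppoly1 => t0.
by rewrite c1 mul1r mulr1 divff // subrr mulr0 subr0 oppr0.
Qed.

Lemma raise_coefS i : (i.+4 <= D)%N -> raise_coef i.+1 = c i.+1 * mid_coef i.
Proof.
move=> iD; have P2 := p_neq0 iD.
have cc1 : c i.+1 != 0 by apply: cR_neq0 => //; lia.
have cc2 : c i.+2 != 0 by apply: cR_neq0 => //; lia.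
have := ppoly_rec t (ltnW (ltnW iD)).
rewrite /raise_coef /mid_coef => ->; field.
by rewrite cc1 P2 cc2.
Qed.

Lemma lower_coefE i : (i.+4 <= D)%N ->
  lower_coef i = b i + c i.+2 * mid_coef i - raise_coef i.
Proof.
move=> iD; have P2 := p_neq0 iD; have P1 := p_neq0 (ltnW iD).
have cc1 : c i.+1 != 0 by apply: cR_neq0 => //; lia.
have cc2 : c i.+2 != 0 by apply: cR_neq0 => //; lia.
have rec := ppoly_rec t (ltnW iD).
have c3E : c i.+3 * P i.+3 = t * P i.+2 - b i.+3 * P i.+1 by rewrite rec addrK.
have bE : b i = b i.+2 + c i.+2 - c i by apply: bc_sum; lia.
have -> : lower_coef i =
    b i.+2 * P i * (c i.+3 * P i.+3) / (c i.+1 * P i.+1 * P i.+2).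
  by rewrite /lower_coef; congr (_ / _); ring.
rewrite c3E /raise_coef /mid_coef bE; field.
by rewrite cc1 cc2 P1 P2.
Qed.

Lemma lower_coef_neq0 i : (i.+4 < D)%N -> lower_coef i != 0.
Proof.
move=> iD; rewrite /lower_coef !mulf_neq0 ?invr_eq0 ?mulf_neq0 //;
  by [apply: p_neq0; lia | apply: bR_neq0 => //; lia | apply: cR_neq0 => //; lia].
Qed.

(** The relation that determines [mid_coef (i + 1)], in the form in which
    [thin_coefs] meets it. *)
Lemma mid_coefS i : (i.+4 < D)%N ->
  b i.+2 * mid_coef i - c i.+4 * (1 + mid_coef i) =
  mid_coef i.+1 * lower_coef i - (raise_coef i + c i).
Proof.
move=> iD; have P3 := p_neq0 iD; have P2 := p_neq0 (ltnW iD).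
have P1 := p_neq0 (ltnW (ltnW iD)).
have cc1 : c i.+1 != 0 by apply: cR_neq0 => //; lia.
have cc2 : c i.+2 != 0 by apply: cR_neq0 => //; lia.
have cc3 : c i.+3 != 0 by apply: cR_neq0 => //; lia.
have ratio : (1 + mid_coef i.+1) * lower_coef i = b i.+4 * (1 + mid_coef i).
  rewrite /mid_coef /lower_coef; field.
  by rewrite cc1 cc2 cc3 P1 P2 P3.
have b4E : b i.+4 = b i.+2 + c i.+2 - c i.+4 by apply: bc_sum; lia.
have bE : b i = b i.+2 + c i.+2 - c i by apply: bc_sum; lia.
move: ratio; rewrite mulrDl mul1r {1}lower_coefE ?(ltnW iD) // b4E bE.
lra.
Qed.

(** At [i = D - 4] this ends the chain [v_0, v_1, ...], since [p_(D-1)]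
    vanishes at [t]. *)
Lemma lower_coef_last i : P i.+3 = 0 -> lower_coef i = 0.
Proof. by move=> P0; rewrite /lower_coef P0 mulr0 mul0r. Qed.

Local Notation K i := ((knum e i)%:R * b i * b i.+1).

Let K_neq0 i : (i.+2 <= D)%N -> K i != 0.
Proof.
by move=> iD; rewrite !mulf_neq0 ?knR_neq0 ?bR_neq0 //; lia.
Qed.

Let K_rec i : c i.+1 * K i.+1 = b i.+2 * K i.
Proof. by have := knR_rec i => kE; rewrite !mulrA -[c i.+1 * _]mulrC kE; ring. Qed.

(** The kernel polynomial at [t] of the sequence [p_h], restricted to indices
    of one parity; [K h] is the squared norm of [p_h] up to a common factor. *)
Definition kernel_sum i a :=
  \sum_(h < i.+1 | ~~ odd (i - h)) P h / K h * p h a.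

Lemma gpolyE i a : (i.+2 <= D)%N ->
  (gpoly e t i).[a] = K i / P i * kernel_sum i a.
Proof.
move=> iD; rewrite horner_sum mulr_sumr; apply: eq_bigr => h _.
have hi : (h.+2 <= D)%N by have := ltn_ord h; lia.
have := K_neq0 hi; have := p_neq0 iD; rewrite hornerZ => Pi Kh; field.
move: Kh; rewrite !mulf_eq0 !negb_or => /andP[/andP[-> ->] ->].
by rewrite Pi.
Qed.

Lemma kernel_sumSS i a :
  kernel_sum i.+2 a = kernel_sum i a + P i.+2 / K i.+2 * p i.+2 a.
Proof. exact: (same_parity_sumSS (fun h => P h / K h * p h a)). Qed.

Lemma kernel_sum0 a : kernel_sum 0 a = (K 0)^-1.
Proof. by rewrite /kernel_sum big_mkcond big_ord1 /= !ppoly0 mulr1 mul1r. Qed.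

Lemma kernel_sum1 a : kernel_sum 1 a = t * a / K 1.
Proof.
by rewrite /kernel_sum big_mkcond big_ord_recr big_ord1 /= add0r !ppoly1 // mulrAC.
Qed.

(** A Christoffel-Darboux identity, for one step of the three-term recurrence. *)
Lemma kernel_sum_rec i a : (i.+4 <= D)%N ->
  a * kernel_sum i.+1 a =
  t * kernel_sum i a + b i.+3 * P i.+1 * p i.+2 a / K i.+2.
Proof.
have rec := ppoly_rec (_ : R).
(* [V j] hides the inverse of [K j], a product, from [ring]. *)
have [V VE] : exists V : nat -> R, forall j, (K j)^-1 = V j.
  by exists (fun j => (K j)^-1).
have VS j : (j.+3 <= D)%N -> b j.+2 * V j.+1 = c j.+1 * V j.
  move=> jD; have K0 := @K_neq0 j (ltnW jD); have K1 := @K_neq0 j.+1 jD.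
  by rewrite -!VE; apply/eqP; rewrite eqr_div // K_rec.
rewrite VE; elim/ltn_ind: i => -[|[|i]] IH iD.
- have aE := rec 0%N a (ltnW (ltnW iD)).
  have V0 := VS 0%N (ltnW iD); have V1 := VS 1%N iD.
  move: aE V0; rewrite kernel_sum0 kernel_sum1 !VE ppoly0 !ppoly1 // c1 mul1r mulr1.
  move=> aE V0; transitivity (t * V 1%N * (a * a)); first by ring.
  rewrite aE -V0; transitivity (t * b 2 * V 1%N + t * p 2 a * (c 2 * V 1%N)).
    by ring.
  by rewrite -V1; ring.
- have aE := rec 1%N a (ltnW (ltnW iD)); have tE := rec 0%N t (ltnW (ltnW (ltnW iD))).
  have V0 := VS 0%N (ltnW (ltnW iD)); have V1 := VS 1%N (ltnW iD).
  have V2 := VS 2%N iD.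
  move: aE tE V0; rewrite kernel_sumSS kernel_sum0 kernel_sum1 !VE ppoly0 !ppoly1 //.
  rewrite c1 mul1r mulr1 => aE tE V0.
  transitivity (a * V 0%N + P 2 * V 2%N * (a * p 2 a)); first by ring.
  rewrite aE -V0; transitivity (b 2 * V 1%N * a + P 2 * p 3 a * (c 3 * V 2%N)
     + P 2 * a * (b 3 * V 2%N)); first by ring.
  rewrite -V2 V1.
  transitivity ((c 2 * P 2 + b 2) * V 1%N * a + b 4 * P 2 * p 3 a * V 3%N).
    by ring.
  by rewrite -tE; ring.
have iD2 : (i.+4 <= D)%N by lia.
have aE := rec i.+2 a (ltnW (ltnW iD)); have tE := rec i.+1 t (ltnW (ltnW (ltnW iD))).
have V3 := VS i.+2 (ltnW iD); have V4 := VS i.+3 iD.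
rewrite [kernel_sum i.+3 a]kernel_sumSS [kernel_sum i.+2 a]kernel_sumSS mulrDr IH //.
rewrite !VE; transitivity (t * kernel_sum i a + b i.+3 * P i.+1 * p i.+2 a * V i.+2
  + P i.+3 * V i.+3 * (a * p i.+3 a)); first by ring.
rewrite aE; transitivity (t * kernel_sum i a + b i.+3 * P i.+1 * p i.+2 a * V i.+2
  + P i.+3 * p i.+4 a * (c i.+4 * V i.+3) + P i.+3 * p i.+2 a * (b i.+4 * V i.+3)).
  by ring.
rewrite -V4 V3; transitivity (t * kernel_sum i a + p i.+2 a * V i.+2 *
   (c i.+3 * P i.+3 + b i.+3 * P i.+1) + b i.+4.+1 * P i.+3 * p i.+4 a * V i.+4).
  by ring.
by rewrite -tE; ring.
Qed.

Lemma gpoly0 a : (gpoly e t 0).[a] = 1.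
Proof.
rewrite gpolyE; last by lia.
by rewrite kernel_sum0 ppoly0 divr1 divff // K_neq0 //; lia.
Qed.

Lemma gpoly1 a : (gpoly e t 1).[a] = a.
Proof.
have P1 := p_neq0 (ltnW D_ge4); have K1 : K 1 != 0 by apply: K_neq0; lia.
have P1E : P 1 = t by rewrite ppoly1.
rewrite gpolyE ?kernel_sum1; last by lia.
move: P1 K1; rewrite P1E; move: (K 1) => k1 t0 K1.
by field; rewrite t0 K1.
Qed.

Lemma gpoly_rec i a : (i.+4 <= D)%N ->
  a * (gpoly e t i.+1).[a] =
  c i.+2 * (gpoly e t i.+2).[a] + lower_coef i * (gpoly e t i).[a].
Proof.
move=> iD; have P2 := p_neq0 iD; have P1 := p_neq0 (ltnW iD).
have P0 := p_neq0 (ltnW (ltnW iD)).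
have cc1 : c i.+1 != 0 by apply: cR_neq0 => //; lia.
have cc2 : c i.+2 != 0 by apply: cR_neq0 => //; lia.
have b3 : b i.+3 != 0 by apply: bR_neq0 => //; lia.
have K0 : K i != 0 by apply: K_neq0; lia.
have K1 : K i.+1 != 0 by apply: K_neq0; lia.
have K2 : K i.+2 != 0 by apply: K_neq0; lia.
have rec := ppoly_rec t (ltnW iD).
have c3E : c i.+3 * P i.+3 = t * P i.+2 - b i.+3 * P i.+1 by rewrite rec addrK.
have cK1 := K_rec i; have cK2 := K_rec i.+1.
rewrite (gpolyE a (ltnW iD)) (gpolyE a iD) (gpolyE a (ltnW (ltnW iD))).
rewrite mulrCA kernel_sum_rec //.
have pS : p i.+2 a = (kernel_sum i.+2 a - kernel_sum i a) * K i.+2 / P i.+2.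
  rewrite kernel_sumSS; move: (K i.+2) (P i.+2) K2 P2 => k2 q2 K2 P2.
  by field; rewrite P2 K2.
have lowE : lower_coef i =
    b i.+2 * P i * (c i.+3 * P i.+3) / (c i.+1 * P i.+1 * P i.+2).
  by rewrite /lower_coef; congr (_ / _); ring.
rewrite pS lowE c3E; move: cK1 cK2 K0 K1 K2 P0 P1 P2.
move: (K i) (K i.+1) (K i.+2) (P i) (P i.+1) (P i.+2) => k0 k1 k2 q0 q1 q2.
move: (kernel_sum i a) (kernel_sum i.+2 a) => s0 s2 cK1 cK2 K0 K1 K2 P0 P1 P2.
have -> : k2 = b i.+3 * k1 / c i.+2 by rewrite -cK2; field.
have b2 : b i.+2 != 0 by apply: bR_neq0 => //; lia.
have -> : k0 = c i.+1 * k1 / b i.+2 by rewrite cK1; field.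
by field; rewrite cc1 cc2 b2 b3 K1 P0 P1 P2.
Qed.

Lemma kernel_sum_gt0 i : (i.+2 <= D)%N -> 0 < kernel_sum i t.
Proof.
move=> iD; have K_gt0 m : (m.+2 <= D)%N -> 0 < K m.
  by move=> mD; rewrite lt0r K_neq0 //= !mulr_ge0.
have term_ge0 m : (m.+2 <= D)%N -> 0 <= P m / K m * P m.
  by move=> mD; rewrite mulrAC -expr2 mulr_ge0 ?sqr_ge0 // invr_ge0 ltW ?K_gt0.
rewrite /kernel_sum big_mkcond big_ord_recr /= subnn; apply: ltr_wpDl.
  apply: sumr_ge0 => h _; case: ifP => // _; apply: term_ge0.
  by have := ltn_ord h; lia.
rewrite mulrAC -expr2 mulr_gt0 ?invr_gt0 ?K_gt0 // lt0r sqr_ge0 andbT.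
by rewrite expf_neq0 // p_neq0.
Qed.

(** At [t] the kernel polynomial is a sum of squares, and it is even or odd. *)
Lemma gpoly_opp_neq0 i (s : bool) : (i.+2 <= D)%N ->
  (gpoly e t i).[(-1) ^+ s * t] != 0.
Proof.
move=> iD; have neq0 : (gpoly e t i).[t] != 0.
  rewrite gpolyE // mulf_neq0 ?(lt0r_neq0 (kernel_sum_gt0 iD)) //.
  by rewrite mulf_neq0 ?invr_eq0 ?p_neq0 ?K_neq0.
case: s; last by rewrite mul1r.
rewrite expr1 mulN1r; suff -> : (gpoly e t i).[- t] = (-1) ^+ i * (gpoly e t i).[t].
  by rewrite mulf_neq0 // signr_eq0.
rewrite !gpolyE // mulrCA; congr (_ * _); rewrite mulr_sumr.
apply: eq_bigr => h odd_ih; rewrite ppoly_parity mulrCA; congr (_ * _).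
have := ltn_ord h; rewrite ltnS => hi.
rewrite -[in RHS](subnK hi) exprD.
by rewrite -[_ ^+ (i - h)]signr_odd (negbTE odd_ih) mul1r.
Qed.

End KernelPolynomials.

(** * Raising and lowering around a vertex *)

Section Module.
Variable x : X.

Local Notation dist := (gdist e).
Local Notation D := (diameter e).
Local Notation vec := 'cV[R[i]]_#|X|.
Local Notation b i := ((bnum e i)%:R : R[i]).
Local Notation c i := ((cnum e i)%:R : R[i]).
Local Notation A := (adj_mx R e).
Local Notation Ad := (dist_mx R e).
Local Notation Es := (dual_idem R e x).

Lemma dual_idemE i (w : vec) y :
  (Es i *m w) y 0 = if dist x (enum_val y) == i then w y 0 else 0.
Proof. by rewrite mul_diag_mx !mxE; case: eqP => _; rewrite ?mul1r ?mul0r. Qed.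

Lemma dual_idem_id i (w : vec) : Es i *m (Es i *m w) = Es i *m w.
Proof. by apply/colP => y; rewrite !dual_idemE; case: eqP. Qed.

Lemma adjE (w : vec) y :
  (A *m w) y 0 = \sum_(z | dist (enum_val y) (enum_val z) == 1%N) w z 0.
Proof.
rewrite mxE [RHS]big_mkcond; apply: eq_bigr => z _; rewrite !mxE.
by case: eqP => _; rewrite ?mul1r ?mul0r.
Qed.

(** In a bipartite graph a neighbour of a vertex of one sphere around [x] lies
    in one of the two adjacent spheres. *)
Lemma dual_adj i (w : vec) : Es i.+1 *m (A *m w) =
  Es i.+1 *m (A *m (Es i *m w)) + Es i.+1 *m (A *m (Es i.+2 *m w)).
Proof.
apply/colP => y; rewrite [RHS]mxE !dual_idemE.
case: eqP => [dy|]; last by rewrite addr0.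
rewrite !adjE -big_split /=; apply: eq_bigr => z /eqP dyz; rewrite !dual_idemE.
have := neighbour_gap x dyz.
rewrite ![dist _ x]gdist_sym // dy => -[->|[->]].
  by rewrite eqxx (gtn_eqF (ltnW (ltnSn _))) add0r.
by rewrite eqxx (ltn_eqF (ltnW (ltnSn _))) addr0.
Qed.

(** The decomposition of [A] into its lowering and its raising part. *)
Lemma adj_dual i (w : vec) : A *m (Es i.+1 *m w) =
  Es i *m (A *m (Es i.+1 *m w)) + Es i.+2 *m (A *m (Es i.+1 *m w)).
Proof.
apply/colP => y; rewrite [RHS]mxE !dual_idemE.
case: (eqVneq (dist x (enum_val y)) i) => [->|ne_i].
  by rewrite ltn_eqF // addr0.
case: (eqVneq (dist x (enum_val y)) i.+2) => [_|ne_i2]; first by rewrite add0r.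
rewrite addr0 adjE big1 // => z /eqP dyz; rewrite dual_idemE; case: eqP => // dz.
have := neighbour_gap x dyz.
by rewrite ![dist _ x]gdist_sym // dz; lia.
Qed.

Definition sqnorm (w : vec) : R[i] := \sum_y `|w y 0| ^+ 2.

Lemma sqnorm_eq0 w : sqnorm w = 0 -> w = 0.
Proof.
move/eqP; rewrite psumr_eq0 => [/allP w0|y _]; last by rewrite exprn_ge0.
apply/colP => y; rewrite mxE; apply/eqP; rewrite -normr_eq0 -sqrf_eq0.
exact: w0 (mem_index_enum _).
Qed.

(** Raising and lowering are mutually adjoint, so that the squared norm of [u]
    is the scalar product of [w] with the lowered [u]. *)
Lemma raise_eq0 i (u w : vec) : Es i *m w = w ->
  Es i.+1 *m (A *m w) = u -> Es i *m (A *m u) = 0 -> u = 0.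
Proof.
move=> wE uE Lu; apply: sqnorm_eq0.
transitivity (\sum_y (A *m w) y 0 * Num.conj (u y 0)).
  apply: eq_bigr => y _; rewrite normCK -uE dual_idemE.
  by case: eqP => _; rewrite ?mul0r ?rmorph0 ?mulr0.
transitivity (\sum_z w z 0 * Num.conj ((A *m u) z 0)).
  under eq_bigr => y _ do rewrite mxE mulr_suml.
  rewrite exchange_big; apply: eq_bigr => z _; rewrite [(A *m u) z 0]mxE.
  rewrite rmorph_sum mulr_sumr; apply: eq_bigr => y _.
  rewrite -mulrA mulrCA rmorphM; congr (_ * (_ * _)).
  by rewrite !mxE gdist_sym // rmorph_nat.
rewrite big1 // => z _; move/colP/(_ z): Lu; rewrite -wE !dual_idemE [(0 : vec) z 0]mxE.
by case: eqP => _ Au0; rewrite ?Au0 ?rmorph0 ?mulr0 ?mul0r.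
Qed.

(** * Thin modules of endpoint 2 *)

Section Thin.
Variable W : {vspace vec}.
Hypothesis W_mod : Tmodule e x W.
Hypothesis W_thin : thin e x W.
Hypothesis W_end : endpoint e x W = 2%N.

Lemma mx_imgP (B : 'M[R[i]]_#|X|) (u : vec) :
  reflect (exists2 w, w \in W & u = B *m w) (u \in mx_img B W).
Proof.
by apply: (iffP memv_imgP) => -[w wW ->]; exists w => //; rewrite lfunE.
Qed.

Lemma adj_closed w : w \in W -> A *m w \in W.
Proof. by apply: W_mod; apply: gen_base; left. Qed.

Lemma dual_closed i w : (i <= D)%N -> w \in W -> Es i *m w \in W.
Proof. by move=> iD; apply: W_mod; apply: gen_base; right; exists i. Qed.

Lemma dist_closed i w : w \in W -> Ad i *m w \in W.
Proof.
move=> wW; suff: Ad i *m w \in W /\ Ad i.+1 *m w \in W by case.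
elim: i => [|i [IH1 IH2]].
  by rewrite dist_mx0 // mul1mx; split=> //; exact: adj_closed.
split; first exact: IH2.
have [iD|iD] := leqP i.+2 D; last first.
  by rewrite (dist_mx_gt iD) mul0mx mem0v.
have c0 : c i.+2 != 0 by rewrite pnatr_eq0 -lt0n cnum_gt0.
have -> : Ad i.+2 = (c i.+2)^-1 *: (A *m Ad i.+1 - b i *: Ad i).
  by rewrite adj_dist_mxS addrC addKr scalerK.
rewrite -scalemxAl; apply: memvZ; rewrite mulmxBl -mulmxA -scalemxAl.
by apply: memvB; [exact: adj_closed | exact: memvZ].
Qed.

Lemma below_endpoint i w : (i < 2)%N -> w \in W -> Es i *m w = 0.
Proof.
move=> i2 wW; have i2' := i2; rewrite -W_end in i2'.
have := before_find 0%N i2'.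
have iD : (i < D.+1)%N.
  apply: leq_trans i2' _; rewrite /endpoint -[X in (_ <= X)%N](size_iota 0).
  exact: find_size.
rewrite nth_iota // => /negbFE/eqP img0; apply/eqP; rewrite -memv0 -img0.
by apply/mx_imgP; exists w.
Qed.

Lemma thin_multiple i u w : (i <= D)%N -> u \in W -> w \in W ->
  Es i *m u != 0 -> exists a, Es i *m w = a *: (Es i *m u).
Proof.
move=> iD uW wW u0; apply/vlineP.
have uI : Es i *m u \in mx_img (Es i) W by apply/mx_imgP; exists u.
have wI : Es i *m w \in mx_img (Es i) W by apply/mx_imgP; exists w.
have sub : (<[Es i *m u]> <= mx_img (Es i) W)%VS by rewrite -memvE.
have/eqP -> // : <[Es i *m u]>%VS == mx_img (Es i) W.
by rewrite eqEdim sub dim_vline u0 W_thin.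
Qed.

Variable v : vec.
Hypothesis vW : v \in W.
Hypothesis v2 : Es 2 *m v = v.

(** The components at distance [i + 2] from [x] of the three [A_j v] that can
    reach it: a vertex of that sphere is at distance [i], [i + 2] or [i + 4]
    from those of the support of [v]. *)
Definition top_vec i := Es i.+2 *m (Ad i *m v).
Definition mid_vec i := Es i.+2 *m (Ad i.+2 *m v).
Definition bot_vec i := Es i.+2 *m (Ad i.+4 *m v).

Lemma v_support z : dist x (enum_val z) != 2%N -> v z 0 = 0.
Proof. by rewrite -v2 dual_idemE => /negbTE ->. Qed.

Lemma dist_vE i y :
  (Ad i *m v) y 0 = \sum_(z | dist (enum_val y) (enum_val z) == i) v z 0.
Proof.
rewrite mxE [RHS]big_mkcond; apply: eq_bigr => z _; rewrite !mxE.
by case: eqP => _; rewrite ?mul1r ?mul0r.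
Qed.

Lemma dist_far h j : (j.+2 < h)%N -> Es h *m (Ad j *m v) = 0.
Proof.
move=> jh; apply/colP => y; rewrite dual_idemE [RHS]mxE; case: eqP => // dy.
rewrite dist_vE big1 // => z /eqP dyz; apply: v_support; apply/eqP => dz.
have := gdist_triangle x (enum_val z) (enum_val y).
by rewrite dy dz gdist_sym // dyz; lia.
Qed.

(** [E*_0 A_2 v = 0] since [W] has no component in [E*_0]. *)
Lemma sum_v_eq0 : \sum_y v y 0 = 0.
Proof.
have := below_endpoint (isT : (0 < 2)%N) (dist_closed 2 vW).
move/colP/(_ (enum_rank x)); rewrite dual_idemE enum_rankK gdistxx eqxx.
rewrite [(0 : vec) _ 0]mxE => Ad2v.
rewrite -[RHS]Ad2v dist_vE enum_rankK [RHS]big_mkcond; apply: eq_bigr => z _.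
by case: ifP => // /negbT/v_support.
Qed.

(** The three matrices add up to [J] between the two spheres, and [J v = 0]. *)
Lemma top_mid_bot i : top_vec i + mid_vec i + bot_vec i = 0.
Proof.
apply/colP => y; rewrite [RHS]mxE [LHS]mxE [X in X + _]mxE !dual_idemE.
case: eqP => [dy|_]; last by rewrite !addr0.
rewrite !dist_vE -[RHS]sum_v_eq0 ![\sum_(z | _ == _) _]big_mkcond -!big_split /=.
apply: eq_bigr => z _.
have [dz|/eqP dz] := eqVneq (dist x (enum_val z)) 2%N; last first.
  by rewrite v_support; [rewrite !if_same !addr0|apply/eqP].
have := gdist_triangle (enum_val y) x (enum_val z).
have := gdist_triangle x (enum_val z) (enum_val y).
have := gdist_parity (enum_val y) x (enum_val z).
rewrite dz [dist (enum_val y) x]gdist_sym // [dist (enum_val z) _]gdist_sym // dy.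
move: (dist _ _) => m; rewrite /= !negbK addbF => par le1 le2.
have [->|[->|->]] : m = i \/ m = i.+2 \/ m = i.+4 by lia.
- by rewrite eqxx !ltn_eqF ?addr0 //; lia.
- by rewrite eqxx gtn_eqF ?ltn_eqF ?addr0 ?add0r //; lia.
by rewrite eqxx !gtn_eqF ?add0r //; lia.
Qed.

Lemma adj_dist_vS i :
  A *m (Ad i.+1 *m v) = b i *: (Ad i *m v) + c i.+2 *: (Ad i.+2 *m v).
Proof. by rewrite mulmxA adj_dist_mxS // mulmxDl -!scalemxAl. Qed.

Lemma raise_top i : Es i.+3 *m (A *m top_vec i) = c i.+1 *: top_vec i.+1.
Proof.
have far : Es i.+4 *m (Ad i *m v) = 0 by apply: dist_far.
have := dual_adj i.+2 (Ad i *m v); rewrite far !mulmx0 addr0 => <-.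
case: i far => [|i] _.
  by rewrite dist_mx0 mul1mx cnum1 scale1r.
rewrite adj_dist_vS mulmxDr -scalemxAr dist_far; last exact: ltnW.
by rewrite scaler0 add0r -scalemxAr.
Qed.

(** The part of [A A_{i+1} v] at distance [i + 2] from [x], computed from the
    expansion of [A A_{i+1}] and from its neighbouring spheres. *)
Lemma adj_dist_split1 i : b i *: top_vec i + c i.+2 *: mid_vec i =
  Es i.+2 *m (A *m top_vec i.+1) + Es i.+2 *m (A *m (Es i.+1 *m (Ad i.+1 *m v))).
Proof.
rewrite [RHS]addrC -[RHS]dual_adj adj_dist_vS mulmxDr.
by congr (_ + _); rewrite -scalemxAr.
Qed.

(** The same comparison for [A A_{i+3} v]. *)
Lemma adj_dist_split3 i : b i.+2 *: mid_vec i + c i.+4 *: bot_vec i =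
  Es i.+2 *m (A *m mid_vec i.+1) + Es i.+2 *m (A *m (Es i.+1 *m (Ad i.+3 *m v))).
Proof.
rewrite [RHS]addrC -[RHS]dual_adj adj_dist_vS mulmxDr.
by congr (_ + _); rewrite -scalemxAr.
Qed.

Lemma adj_top0 : A *m top_vec 0 = c 1 *: top_vec 1.
Proof.
have D2 : (2 <= D)%N by lia.
rewrite -raise_top [LHS]adj_dual (below_endpoint (isT : (1 < 2)%N)) ?add0r //.
by apply/adj_closed/dual_closed/dist_closed.
Qed.

Variables (theta : nat -> R) (n : nat).
Hypothesis theta_eig : ordered_eigenvalues e D theta.
Hypothesis n_mid : (0 < n < D)%N.
Local Notation t := (theta n).
Hypothesis p_neq0 : forall i, (i.+2 <= D)%N -> (ppoly R e i).[t] != 0.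
Hypothesis v_neq0 : v != 0.
Hypothesis v_local : mid_vec 0 = (mid_coef t 0)%:C *: v.

Local Notation mid i := (mid_coef t i)%:C.
Local Notation raise i := (raise_coef t i)%:C.
Local Notation lower i := (lower_coef t i)%:C.

Lemma top_vec0 : top_vec 0 = v.
Proof. by rewrite /top_vec dist_mx0 // mul1mx. Qed.

Let natC (m : nat) : (m%:R : R[i]) = (m%:R : R)%:C.
Proof. by rewrite rmorph_nat. Qed.

Let lower_topE i : (i.+4 <= D)%N -> mid_vec i = mid i *: top_vec i ->
  Es i.+2 *m (A *m (Es i.+1 *m (Ad i.+1 *m v))) = raise i *: top_vec i ->
  Es i.+2 *m (A *m top_vec i.+1) = lower i *: top_vec i.
Proof.
move=> iD midE upE; apply/(addIr (raise i *: top_vec i)).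
rewrite -{1}upE -adj_dist_split1 midE scalerA -!scalerDl; congr (_ *: _).
rewrite lower_coefE // !natC -rmorphM -!rmorphD; congr (_%:C).
by rewrite /= subrK.
Qed.

(** From [i] to [i + 1]: the first comparison gives the scalar by which
    [v_{i+1}] is lowered; it is nonzero, so [v_{i+1}] is nonzero and spans its
    component of [W]; thinness then provides the scalar of [mid_vec (i + 1)],
    and the second comparison its value. *)
Lemma thin_coefs i : (i.+4 <= D)%N ->
  [/\ top_vec i != 0, mid_vec i = mid i *: top_vec i,
      Es i.+2 *m (A *m (Es i.+1 *m (Ad i.+1 *m v))) = raise i *: top_vec i &
      Es i.+2 *m (A *m (Es i.+1 *m (Ad i.+3 *m v))) =
        - (raise i + c i) *: top_vec i].
Proof.
elim: i => [|i IH] iD.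
  have b1 w : w \in W -> Es 1 *m w = 0 by apply: below_endpoint.
  rewrite top_vec0 v_local v_neq0 !b1 ?dist_closed // !mulmx0.
  by rewrite raise_coef0 // cnum0 // addr0 oppr0 !scale0r.
have [top_neq0 midE upE botE] := IH (ltnW iD).
have lowerE := lower_topE (ltnW iD) midE upE.
have top1_neq0 : top_vec i.+1 != 0.
  apply: contraTneq (lower_coef_neq0 p_neq0 iD) => top0.
  have := lowerE; rewrite top0 !mulmx0 => /esym/eqP.
  by rewrite scaler_eq0 (negbTE top_neq0) orbF fmorph_eq0 negbK.
have [a midSE] : exists a, mid_vec i.+1 = a *: top_vec i.+1.
  by apply: thin_multiple => //; rewrite ?dist_closed //; lia.
have up1E : Es i.+3 *m (A *m mid_vec i) = raise i.+1 *: top_vec i.+1.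
  rewrite midE -scalemxAr -scalemxAr raise_top scalerA; congr (_ *: _).
  by rewrite (raise_coefS p_neq0 (ltnW iD)) rmorphM /= rmorph_nat mulrC.
have bot1E : Es i.+3 *m (A *m bot_vec i) = - (raise i.+1 + c i.+1) *: top_vec i.+1.
  have -> : bot_vec i = - (top_vec i + mid_vec i).
    by apply/eqP; rewrite -addr_eq0 addrC top_mid_bot.
  rewrite mulmxN mulmxN mulmxDr mulmxDr raise_top up1E -scalerDl -scaleNr.
  by congr (_ *: _); rewrite addrC.
suff aE : a = mid i.+1.
  by rewrite aE in midSE; apply: And4 top1_neq0 midSE up1E bot1E.
have bot0E : bot_vec i = - (1 + mid i) *: top_vec i.
  apply/eqP; rewrite scaleNr scalerDl scale1r -midE -addr_eq0 addrC.
  by rewrite top_mid_bot.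
have := adj_dist_split3 i.
rewrite midSE botE midE bot0E -!scalemxAr lowerE !scalerA -!scalerDl.
move/eqP; rewrite -subr_eq0 -scalerBl scaler_eq0 (negbTE top_neq0) orbF subr_eq0.
rewrite !natC => /eqP aE.
have lower_neq0 : lower i != 0.
  by rewrite fmorph_eq0 (lower_coef_neq0 p_neq0).
apply: (mulIf lower_neq0).
have := mid_coefS p_neq0 iD.
move: aE {lower_neq0 upE lowerE midE botE up1E bot1E bot0E}.
move: (mid_coef t i) (mid_coef t i.+1) (lower_coef t i) (raise_coef t i).
move=> f0 f1 l r aE /(congr1 (real_complex R)).
rewrite !rmorphB !rmorphM !rmorphD rmorph1 /= => fE.
by move: aE; rewrite mulrN fE => /addIr.
Qed.

Lemma lower_top_thin i : (i.+4 <= D)%N ->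
  Es i.+2 *m (A *m top_vec i.+1) = lower i *: top_vec i.
Proof. by move=> iD; have [_ midE upE _] := thin_coefs iD; exact: lower_topE. Qed.

Lemma adj_topS i : (i.+4 <= D)%N ->
  A *m top_vec i.+1 = c i.+2 *: top_vec i.+2 + lower i *: top_vec i.
Proof.
move=> iD; rewrite [LHS]adj_dual (lower_top_thin iD) raise_top.
exact: addrC.
Qed.

Lemma top_vec_last m : m.+4 = D -> (ppoly R e m.+3).[t] = 0 -> top_vec m.+1 = 0.
Proof.
move=> mD P0; have c0 : c m.+1 != 0.
  by rewrite pnatr_eq0 -lt0n cnum_gt0 //; lia.
apply: (scalerI c0); rewrite scaler0 -raise_top.
apply: (raise_eq0 (i := m.+2) (w := top_vec m)); rewrite ?dual_idem_id //.
rewrite raise_top -!scalemxAr lower_top_thin ?mD // (lower_coef_last P0).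
by rewrite scale0r scaler0.
Qed.

Local Notation E j := (prim_idem e (theta j)%:C).

(** This is [v_i = g_i(A) v], read on each eigenspace. *)
Lemma prim_idem_top i j : (i.+3 <= D)%N -> (j <= D)%N ->
  E j *m top_vec i = ((gpoly e t i).[theta j])%:C *: (E j *m v).
Proof.
move=> + jD; have E_adj u : E j *m (A *m u) = (theta j)%:C *: (E j *m u).
  by rewrite mulmxA (prim_idem_adj theta_eig) // scalemxAl.
suff: ((i.+3 <= D)%N ->
    E j *m top_vec i = ((gpoly e t i).[theta j])%:C *: (E j *m v)) /\
  ((i.+4 <= D)%N ->
    E j *m top_vec i.+1 = ((gpoly e t i.+1).[theta j])%:C *: (E j *m v)).
  by case.
elim: i => [|i [IH1 IH2]].
  rewrite (gpoly0 p_neq0) (gpoly1 p_neq0) scale1r top_vec0; split=> // _.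
  by rewrite -E_adj; have := adj_top0; rewrite top_vec0 cnum1 scale1r => ->.
split=> // iD; have c0 : c i.+2 != 0.
  by rewrite pnatr_eq0 -lt0n cnum_gt0 //; do 3!apply: ltnW.
apply: (scalerI c0); rewrite scalemxAr.
have -> : c i.+2 *: top_vec i.+2 = A *m top_vec i.+1 - lower i *: top_vec i.
  by rewrite adj_topS ?(ltnW iD) // addrK.
rewrite mulmxBr E_adj -scalemxAr IH2 ?(ltnW iD) // IH1 ?(ltnW (ltnW iD)) //.
rewrite !scalerA -scalerBl natC -!rmorphM -rmorphB; congr (_%:C *: _).
by rewrite /= (gpoly_rec p_neq0) ?addrK // ltnW.
Qed.

(** As [g_{D-3}(A) v = v_{D-3} = 0], a component of [v] survives only at a
    zero of [g_{D-3}], and neither [t] nor [- t] is one. *)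
Lemma prim_idem_extremal_eq0 (s : bool) j :
  (j <= D)%N -> theta j = (-1) ^+ s * t -> E j *m v = 0.
Proof.
move=> jD tj; have [m mD] : exists m, m.+4 = D by exists (D - 4)%N; lia.
have mle : (m.+1.+3 <= D)%N by rewrite -mD.
have p0 : (ppoly R e m.+3).[t] = 0.
  by rewrite -(ppoly_pred_diameter theta_eig n_mid) -[in RHS]mD.
have g0 : ((gpoly e t m.+1).[theta j])%:C != 0.
  by rewrite tj fmorph_eq0 (gpoly_opp_neq0 p_neq0 _ (ltnW mle)).
apply: (scalerI g0).
by rewrite -(prim_idem_top mle jD) (top_vec_last mD p0) mulmx0 scaler0.
Qed.

(** The all-ones and the alternating vector belong to the eigenvalues [k] and
    [- k], and both are orthogonal to [v]. *)
Lemma prim_idem_ends_eq0 (s : bool) j :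
  (j <= D)%N -> (-1) ^+ s * theta j = (bnum e 0)%:R -> E j *m v = 0.
Proof.
move=> jD tj; have := congr1 (mulmx^~ v) (prim_idem_ones_sign theta_eig s jD).
rewrite -mulmxA tj; set M := \matrix_(y, z) _.
have -> : M *m v = 0.
  apply/colP => y; rewrite [RHS]mxE mxE.
  transitivity (((-1) ^+ s) ^+ (dist (enum_val y) x).+2 * \sum_z v z 0).
    rewrite mulr_sumr; apply: eq_bigr => z _; rewrite mxE.
    have [dz|dz] := eqVneq (dist x (enum_val z)) 2%N; last first.
      by rewrite (v_support dz) !mulr0.
    congr (_ * _); case: s {M tj} => /=; last by rewrite !expr1n.
    by rewrite expr1 (sign_dist _ x) dz -exprD addn2.
  by rewrite sum_v_eq0 mulr0.
rewrite mulmx0 -scalemxAl => /esym/eqP; rewrite scaler_eq0 fmorph_eq0.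
by rewrite gt_eqF ?sum_fpoly_gt0 //= => /eqP.
Qed.

Lemma top_vec_spectral i : (i.+4 <= D)%N ->
  top_vec i = \sum_(1 <= j < D | (j != n) && (j != D - n)%N)
    ((gpoly e t i).[theta j])%:C *: (E j *m v).
Proof.
move=> iD; have [n_gt0 nD] := andP n_mid.
have theta_oppD m : (m <= D)%N -> theta (D - m) = - theta m by exact: theta_opp.
have E0 : E 0%N *m v = 0.
  by apply: (prim_idem_ends_eq0 (s := false)); rewrite ?mul1r ?theta0.
have ED : E D *m v = 0.
  apply: (prim_idem_ends_eq0 (s := true)) => //.
  by rewrite expr1 mulN1r -[in theta _](subn0 D) theta_oppD // opprK theta0.
have En : E n *m v = 0.
  by apply: (prim_idem_extremal_eq0 (s := false)); rewrite ?mul1r // ltnW.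
have EDn : E (D - n)%N *m v = 0.
  apply: (prim_idem_extremal_eq0 (s := true)); first exact: leq_subr.
  by rewrite expr1 mulN1r theta_oppD // ltnW.
rewrite -[LHS]mul1mx -(sum_prim_idem theta_eig) mulmx_suml.
transitivity (\sum_(j < D.+1) ((gpoly e t i).[theta j])%:C *: (E j *m v)).
  by apply: eq_bigr => j _; rewrite prim_idem_top ?leq_ord // ltnW.
apply: (sum_split_zeros (h := fun j => ((gpoly e t i).[theta j])%:C *: (E j *m v))).
- exact: D_gt0.
- by rewrite E0 scaler0.
- by rewrite ED scaler0.
- by rewrite En scaler0.
by rewrite EDn scaler0.
Qed.

End Thin.

End Module.

End BipartiteDistanceRegular.

Theorem theorem13p4 (R : realType) (X : finType) (e : rel X)
    (D n : nat) (theta : nat -> R) (x : X)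
    (W : {vspace 'cV[R[i]]_#|X|}) (v : 'cV[R[i]]_#|X|) :
  connected_simple_graph e ->
  bipartite e ->
  distance_regular e ->
  diameter e = D ->
  (4 <= D)%N ->
  (3 <= valency e)%N ->
  ordered_eigenvalues e D theta ->
  (if odd D then (n = 1%N) \/ (n = D./2) else n = 1%N) ->
  irreducible_Tmodule e x W ->
  thin e x W ->
  endpoint e x W = 2%N ->
  local_eigenvalue e x W
    (- 1 - (bnum e 2)%:R * (bnum e 3)%:R / (theta n ^+ 2 - (bnum e 2)%:R))%:C ->
  v \in mx_img (dual_idem R e x 2) W ->
  v != 0 ->
  forall i : nat, (i <= D - 4)%N ->
    dual_idem R e x (i + 2) *m dist_mx R e i *m v =
    \sum_(1 <= j < D | (j != n) && (j != D - n)%N)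
      ((gpoly e (theta n) i).[theta j])%:C *: (prim_idem e (theta j)%:C *m v).
Proof.
move=> e_simple e_bip e_dr DE; subst D => D_ge4 _ theta_eig n_cond.
case=> W_mod _ _ W_thin W_end v_local vE v_neq0 i iD.
have X_gt0 : (0 < #|X|)%N by apply/card_gt0P; exists x.
have n_mid : (0 < n < diameter e)%N by case: ifP n_cond; lia.
have p_neq0 m : (m.+2 <= diameter e)%N -> (ppoly R e m).[theta n] != 0.
  exact: ppoly_theta_neq0.
have [w wW wE] := elimT (mx_imgP _ _ _) vE.
have v2 : dual_idem R e x 2 *m v = v by rewrite wE dual_idem_id.
have vW : v \in W by rewrite wE; apply: dual_closed => //; lia.
have v_mid : mid_vec e x v 0 = (mid_coef e (theta n) 0)%:C *: v.
  by rewrite mid_coef0 // -(v_local _ vE) -!mulmxA v2.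
rewrite addn2 -mulmxA -/(top_vec e x v i).
by apply: (@top_vec_spectral _ e _ _ _ _ _ _ _ W) => //; lia.
Qed.
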